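(* Let $X\subset\mathbb{R}^d$ be compact and let $f\in\mathrm{PAff}(X;X)$ be a non-degenerate piecewise affine map. Then $$H_{\mathrm{mult}}(f)\le\frac{d(d-1)}{2}\bigl(\lambda_{\max}(f)-\lambda_{\min}(f)\bigr).$$
   Context: **Piecewise affine maps.** A piecewise affine map $(X,\mathcal Z,f)$, written $f\in\mathrm{PAff}(X;X)$, consists of a compact set $X\subset\mathbb{R}^d$, a finite collection $\mathcal Z$ of open, pairwise disjoint polytopes such that $X'=\bigcup_{Z\in\mathcal Z}Z$ is dense in $X$, and a map $f:X'\to X$ such that $f_Z:=f|_Z:Z\to X$ is affine for each $Z\in\mathcal Z$. The $f_Z$ are the affine components of $f$; the linear part of $f_Z$ is $f_Z'$, and $d_xf:=f_Z'$ for $x\in Z$. $f$ is non-degenerate if every $f_Z'$ is invertible. Put $U_n=\bigcap_{k=0}^{n-1}f^{-k}(X')$, the set of points where $f^n$ is defined; for $x\in U_n$, $d_xf^n$ is the corresponding product of linear parts along the orbit. $\mathcal Z^n$ denotes the continuity partition of $f^n$: the collection of all nonempty sets $Z_0\cap f^{-1}(Z_1)\cap\dots\cap f^{-(n-1)}(Z_{n-1})$ with $Z_i\in\mathcal Z$. **Multiplicity entropy.** For $a\in X$, $\mathrm{mult}(\mathcal Z^n,a)=|\{Z\in\mathcal Z^n: a\in\bar Z\}|$, $\mathrm{mult}(\mathcal Z^n)=\sup_{a\in X}\mathrm{mult}(\mathcal Z^n,a)$, and $H_{\mathrm{mult}}(f)=\limsup_{n\to\infty}\frac1n\log\mathrm{mult}(\mathcal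 Z^n)$. **Expansion rates.** $\lambda_{\max}(f)=\limsup_{n\to\infty}\sup_{x\in U_n}\frac1n\log\|d_xf^n\|$ and $\lambda_{\min}(f)=-\limsup_{n\to\infty}\sup_{x\in U_n}\frac1n\log\|(d_xf^n)^{-1}\|$, with operator norms induced by the Euclidean norm. *)

(* Defs.v *)
From HB Require Import structures.
From mathcomp Require Import all_boot all_order all_algebra finmap.
From mathcomp Require Import all_classical all_reals all_analysis.
Import Order.TTheory GRing.Theory Num.Theory.
Import numFieldNormedType.Exports.

Set Implicit Arguments.
Unset Strict Implicit.
Unset Printing Implicit Defensive.

Local Open Scope classical_set_scope.
Local Open Scope ring_scope.

Section EuclideanSpace.
Context {R : realType} {d : nat}.

Definition enorm (x : 'cV[R]_d) : R := Num.sqrt (\sum_(i < d) x i 0 ^+ 2).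

Definition opnorm (A : 'M[R]_d) : R :=
  sup [set enorm (A *m x) | x in [set x | enorm x <= 1]].

(* Polytopes are convex: a bounded intersection of finitely many open
   half-spaces [a_i . x < b_i], the [a_i] being the rows of [A]. *)
Definition open_polytope (Z : set 'cV[R]_d) : Prop :=
  (exists (m : nat) (A : 'M[R]_(m, d)) (b : 'cV[R]_m),
     Z = [set x | forall i, (A *m x) i 0 < b i 0]) /\
  (exists r : R, forall x, Z x -> enorm x <= r).

End EuclideanSpace.

Section PiecewiseAffine.
Context {R : realType} {d : nat}.
Local Notation V := 'cV[R]_d.
Local Notation M := 'M[R]_d.

(* The map f : X' -> X is represented by a total function; nothing below
   depends on its values outside X' = \bigcup_(Z in ZZ) Z. *)
Implicit Types (X : set V) (ZZ : set (set V)) (f : V -> V).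

Definition paff_domain ZZ : set V := \bigcup_(Z in ZZ) Z.

Definition is_linear_part f (Z : set V) (A : M) : Prop :=
  exists b : V, forall x, Z x -> f x = A *m x + b.

Record paff X ZZ f : Prop := Paff {
  paff_compact : compact X ;
  paff_finite : finite_set ZZ ;
  paff_polytope : forall Z, ZZ Z -> open_polytope Z ;
  paff_disjoint : trivIset ZZ id ;
  paff_sub : paff_domain ZZ `<=` X ;
  paff_dense : X `<=` closure (paff_domain ZZ) ;
  paff_maps : forall x, paff_domain ZZ x -> X (f x) ;
  paff_affine : forall Z, ZZ Z -> exists A, is_linear_part f Z A
}.

(* The linear part of f on Z, unique when Z is open and nonempty. *)
Definition linear_part f (Z : set V) : M := get (is_linear_part f Z).

(* An empty piece has no well-defined linear part and is ignored. *)
Definition paff_nondegenerate ZZ f : Prop :=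
  forall Z, ZZ Z -> Z !=set0 -> linear_part f Z \in unitmx.

(* d_x f = linear_part f Z for the unique piece Z containing x. *)
Definition dmap ZZ f (x : V) : M :=
  linear_part f (get [set Z | ZZ Z /\ Z x]).

Fixpoint dmap_iter ZZ f (n : nat) (x : V) : M :=
  if n is n'.+1 then dmap ZZ f (iter n' f x) *m dmap_iter ZZ f n' x else 1%:M.

Definition iter_domain X ZZ f (n : nat) : set V :=
  X `&` [set x | forall k, (k < n)%N -> paff_domain ZZ (iter k f x)].

Definition cont_partition ZZ f (n : nat) : set (set V) :=
  [set W | W !=set0 /\
     exists Zs : nat -> set V, (forall k, (k < n)%N -> ZZ (Zs k)) /\
       W = [set x | forall k, (k < n)%N -> Zs k (iter k f x)]].

(* Used on finite collections only (fset_set is empty on infinite sets). *)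
Definition multiplicity_at (W : set (set V)) (a : V) : nat :=
  #|` fset_set [set Z | W Z /\ closure Z a]|%fset.

Local Open Scope ereal_scope.

(* Extended-real suprema, logarithm (lne 0 = -oo) and limsup are used, so no
   finiteness or positivity is presupposed. *)
Definition multiplicity X (W : set (set V)) : \bar R :=
  ereal_sup [set ((multiplicity_at W a)%:R)%:E | a in X].

Definition H_mult X ZZ f : \bar R :=
  limn_esup (fun n : nat =>
    (n%:R^-1)%:E * lne (multiplicity X (cont_partition ZZ f n))).

Definition lambda_max X ZZ f : \bar R :=
  limn_esup (fun n : nat => ereal_sup
    [set (n%:R^-1)%:E * lne (opnorm (dmap_iter ZZ f n x))%:E
      | x in iter_domain X ZZ f n]).

Definition lambda_min X ZZ f : \bar R :=
  - limn_esup (fun n : nat => ereal_sup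
    [set (n%:R^-1)%:E * lne (opnorm (invmx (dmap_iter ZZ f n x)))%:E
      | x in iter_domain X ZZ f n]).

End PiecewiseAffine.

(* Main.v *)
Require Import Defs.
From mathcomp Require Import all_boot all_order all_algebra finmap.
From mathcomp Require Import all_classical all_reals all_analysis.
From mathcomp Require Import lra ring.
Import Order.TTheory GRing.Theory Num.Theory.
Import numFieldNormedType.Exports.
Set Implicit Arguments.
Unset Strict Implicit.
Unset Printing Implicit Defensive.
Local Open Scope classical_set_scope.
Local Open Scope ring_scope.

(* Near a point [a] the pieces of the n-th partition are polyhedral cones, cut
   out by the dynamics of tangent directions. Refine [a] to a partial flag
   (a, v_1, ..., v_k) of infinitely near directions and count the n-words whose
   cones are adherent to it. The directions transverse to the flag form a sphere
   of dimension d - k - 1 on which a product of n linear parts of condition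
   number kappa expands distances by at most O(kappa), so O(kappa^(d-k-1)) cells
   suffice to keep the directions of a cell close for n steps. By compactness,
   words of length p realized by close directions are all adherent to a common
   flag (a, v_1, ..., v_(k+1)); hence the growth rate for k-flags exceeds that
   for (k+1)-flags by at most (d-k-1)(lambda_max - lambda_min). A full flag lies
   in one piece only, and the sum of d - k - 1 over k < d is d(d-1)/2.

   The sup norm replaces the Euclidean one (only constants change), and the
   quotient by a flag is realized by eliminating a coordinate per direction. *)

(** * The sup norm and stability of finite systems of linear inequalities *)

Section SupNorm.
Context {R : realType}.

Lemma coord_le_norm {d} (x : 'cV[R]_d) i : `|x i 0| <= `|x|.
Proof.
rewrite [ `|x| ]mx_normrE.
exact: (@le_bigmax _ _ _ 0 (fun ij : 'I_d * 'I_1 => `|x ij.1 ij.2|) (i, 0)).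
Qed.

Lemma norm_le_coord {d} (x : 'cV[R]_d) c : 0 <= c ->
  (forall i, `|x i 0| <= c) -> `|x| <= c.
Proof.
move=> c0 h; rewrite [ `|x| ]mx_normrE; apply: bigmax_le => // -[i j] _ /=.
by rewrite (ord1 j).
Qed.

Lemma norm_coord_attained {d} (x : 'cV[R]_d) : x != 0 ->
  exists i, `|x i 0| = `|x|.
Proof.
move=> x0; have : mx_norm x != 0.
  by apply: contra x0 => /eqP/mx_norm_eq0 ->.
by case/mx_norm_neq0 => -[i j] /=; rewrite (ord1 j) => h; exists i.
Qed.

Lemma mulmx_norm_le {m n} (A : 'M[R]_(m, n)) :
  exists2 B : R, 0 <= B & forall x : 'cV[R]_n, `|A *m x| <= B * `|x|.
Proof.
exists (\sum_i \sum_j `|A i j|) => [|x].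
  by apply: sumr_ge0 => i _; apply: sumr_ge0 => j _.
apply: norm_le_coord => [|i].
  by apply: mulr_ge0 => //; apply: sumr_ge0 => i _; apply: sumr_ge0 => j _.
rewrite mxE (le_trans (ler_norm_sum _ _ _))//.
apply: (@le_trans _ _ (\sum_j `|A i j| * `|x|)).
  by apply: ler_sum => j _; rewrite normrM ler_wpM2l// coord_le_norm.
rewrite -mulr_suml ler_wpM2r// (bigD1 i)//= lerDl.
by apply: sumr_ge0 => k _; apply: sumr_ge0 => j _.
Qed.

Lemma trmx_norm {d} (x : 'rV[R]_d) : `|x^T| = `|x|.
Proof.
apply/le_anti/andP; split.
  apply: norm_le_coord => // i; rewrite mxE [leRHS]mx_normrE.
  exact: (@le_bigmax _ _ _ 0 (fun ij : 'I_1 * 'I_d => `|x ij.1 ij.2|) (0, i)).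
rewrite [leLHS]mx_normrE; apply: bigmax_le => // -[i j] _ /=.
by rewrite (ord1 i); have := coord_le_norm x^T j; rewrite mxE.
Qed.

Lemma lincomb_continuous {m n k} (a : 'I_k -> R) (i : 'I_k -> 'I_m)
    (j : 'I_k -> 'I_n) :
  continuous (fun M : 'M[R]_(m, n) => \sum_l a l * M (i l) (j l)).
Proof.
move=> M; apply: (@cvg_big _ _ +%R 0 xpredT _ _ (nbhs M)) => [|l _].
  exact: add_continuous.
by apply: cvgMr; exact: coord_continuous.
Qed.

(* A limit of approximate solutions of a system of linear inequalities solves
   the system; compactness makes the statement uniform. *)
Lemma approx_solution {d} {F : finType} (phi : F -> 'rV[R]_d) (rho : R) :
  0 < rho -> exists2 r : R, 0 < r &
    forall (Psi : {set F}) (u : 'cV[R]_d), `|u| <= 1 ->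
      (forall c, c \in Psi -> (phi c *m u) 0 0 <= r) ->
      exists2 v : 'cV[R]_d, `|u - v| < rho &
        forall c, c \in Psi -> (phi c *m v) 0 0 <= 0.
Proof.
move=> rho0; suff one (Psi : {set F}) : exists2 r : R, 0 < r &
    forall u : 'cV[R]_d, `|u| <= 1 ->
      (forall c, c \in Psi -> (phi c *m u) 0 0 <= r) ->
      exists2 v : 'cV[R]_d, `|u - v| < rho &
        forall c, c \in Psi -> (phi c *m v) 0 0 <= 0.
  pose r Psi := sval (cid2 (one Psi)).
  exists (\big[Num.min/1]_(Psi : {set F}) r Psi).
    apply: lt_bigmin => // Psi _; rewrite /r; by case: cid2.
  move=> Psi u u1 h; apply: (svalP (cid2 (one Psi))).2 => // c cPsi.
  apply: le_trans (h c cPsi) _; exact: bigmin_le.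
pose g (u : 'rV[R]_d) := \big[Num.max/0]_(c in Psi) (phi c *m u^T) 0 0.
have gcont : continuous g.
  move=> u; apply: (@cvg_big R^o F Num.max 0 (mem Psi) _ 'rV[R]_d
    (nbhs u) (index_enum F) (fun c v => (phi c *m v^T) 0 0)
    (fun c => (phi c *m u^T) 0 0)) => [|c _].
    exact: (@max_continuous _ R).
  have lincombE (v : 'rV[R]_d) :
      (phi c *m v^T) 0 0 = \sum_l phi c 0 l * v 0 l.
    by rewrite mxE; apply: eq_bigr => l _; rewrite mxE.
  rewrite lincombE; under eq_cvg do rewrite lincombE.
  exact: (@lincomb_continuous 1 d d (phi c 0) (fun=> 0) id u).
(* [K] is the part of the unit ball at distance at least [rho] from every solution. The largest
   violation [g] is positive there, and half its minimum serves as [r]. *)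
pose K := [set u : 'rV[R]_d | `|u| <= 1] `&`
  \bigcap_(v in [set v : 'rV[R]_d | forall c, c \in Psi ->
     (phi c *m v^T) 0 0 <= 0]) [set u | rho <= `|u - v|].
have Kcompact : compact K.
  apply: bounded_closed_compact.
    exists 1; split => // x x1 u [/= u1 _]; exact: le_trans u1 (ltW x1).
  apply: closedI.
    apply: (@preimage_closed _ _ (fun u : 'rV[R]_d => `|u|)) (@closed_le _ _).
    by move=> u _; exact: norm_continuous.
  apply: closed_bigI => v _ /=.
  apply: (@preimage_closed _ _ (fun u : 'rV[R]_d => `|u - v|)) (@closed_ge _ _).
  move=> u _; apply: (@continuous_comp _ _ _ (fun u : 'rV[R]_d => u - v)
    Num.norm); last exact: norm_continuous.
  apply: continuousB; last exact: cst_continuous.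
  by move=> ?.
have out (u : 'cV[R]_d) : `|u| <= 1 -> ~ K u^T ->
    exists2 v : 'cV[R]_d, `|u - v| < rho &
        forall c, c \in Psi -> (phi c *m v) 0 0 <= 0.
  move=> u1 nK; apply: contrapT => nv; apply: nK; split.
    by rewrite /= -trmx_norm trmxK.
  move=> v /= hv; rewrite leNgt; apply/negP => lt; apply: nv.
  by exists v^T => //; rewrite -(trmxK u) -linearB/= trmx_norm.
have [K0|/nonemptyPn K0] := pselect (K !=set0); last first.
  by exists 1 => // u u1 _; apply: out => //; rewrite K0.
have [u0 /set_mem Ku0 u0min] := compact_EVT_min K0 Kcompact
  (continuous_subspaceT gcont).
have g0 : 0 < g u0.
  rewrite ltNge; apply/negP => g0; have := Ku0.2 u0.
  rewrite /= subrr normr0 => h.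
  suff : rho <= 0 by rewrite leNgt rho0.
  apply: h => c cPsi; apply: le_trans g0.
  exact: (@le_bigmax_cond _ _ _ 0 c (mem Psi) (fun c => (phi c *m u0^T) 0 0)).
exists (g u0 / 2); first by rewrite divr_gt0.
move=> u u1 h; apply: out => // Ku.
have := u0min u^T (mem_set Ku); apply/negP; rewrite -ltNge.
apply: (@le_lt_trans _ _ (g u0 / 2)); last by rewrite ltr_pdivrMr// ltr_pMr// ltr1n.
by apply: bigmax_le => [|c cPsi]; [rewrite ltW// divr_gt0|rewrite trmxK; apply: h].
Qed.

End SupNorm.

(** * Counting by duplicate-free lists *)

Section Counting.
Context {R : realType}.

(** Bounding all duplicate-free lists gives cardinality bounds with real values for predicates that
    are neither decidable nor known to be finite. *)
Definition card_le {T : eqType} (P : T -> Prop) (a : R) : Prop :=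
  forall ws : seq T, uniq ws -> (forall w, w \in ws -> P w) ->
    (size ws)%:R <= a.

Lemma card_le_weak {T : eqType} (P : T -> Prop) (a b : R) :
  card_le P a -> a <= b -> card_le P b.
Proof. by move=> Pa ab ws uws wsP; exact: le_trans (Pa ws uws wsP) ab. Qed.

Lemma card_le1 {T : eqType} (P : T -> Prop) (a : R) : 1 <= a ->
  (forall v w, P v -> P w -> v = w) -> card_le P a.
Proof.
move=> a1 Pirr; case=> [|v [|w ws]] uws wsP /=; rewrite ?(le_trans ler01)//.
have Pv : P v by apply: wsP; exact: mem_head.
have Pw : P w by apply: wsP; rewrite !inE eqxx orbT.
by move: uws; rewrite (Pirr v w Pv Pw)/= mem_head.
Qed.

Lemma card_le_finType {T : finType} (D : {pred T}) (P : T -> Prop) :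
  (forall w, P w -> w \in D) -> card_le P #|D|%:R.
Proof.
move=> PD ws uws wsP; rewrite ler_nat -(card_uniqP uws).
by apply/subset_leq_card/fintype.subsetP => w /wsP/PD.
Qed.

Lemma card_le_inj {T T' : eqType} (g : T -> T') (P : T -> Prop)
    (Q : T' -> Prop) (a : R) :
  card_le Q a -> (forall w, P w -> Q (g w)) ->
  (forall v w, P v -> P w -> g v = g w -> v = w) -> card_le P a.
Proof.
move=> Qa PQ ginj ws uws wsP; rewrite -(size_map g); apply: Qa.
  by rewrite map_inj_in_uniq// => v w /wsP Pv /wsP Pw; exact: ginj.
by move=> _ /mapP[w /wsP/PQ Qw ->].
Qed.

Lemma card_le_fiber {T T' : eqType} (g : T -> T') (P : T -> Prop)
    (Q : T' -> Prop) (a b : R) : 0 <= b ->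
  card_le Q a -> (forall w, P w -> Q (g w)) ->
  (forall v, Q v -> card_le (fun w => P w /\ g w = v) b) -> card_le P (a * b).
Proof.
move=> b0 Qa PQ fib ws uws wsP; set vs := undup (map g ws).
have vsQ v : v \in vs -> Q v.
  by rewrite mem_undup => /mapP[w /wsP/PQ Qw ->].
have -> : size ws = (\sum_(v <- vs) count (fun w => g w == v) ws)%N.
  rewrite -sum1_size [in RHS](eq_bigr (fun v => \sum_(w <- ws) (g w == v))%N).
    rewrite exchange_big/= big_seq [RHS]big_seq; apply: eq_bigr => w wws.
    rewrite (bigD1_seq (g w)) ?undup_uniq//= ?eqxx; last first.
      by rewrite mem_undup map_f.
    by rewrite big1 ?addn0// => v /negPf vgw; rewrite eq_sym vgw.
  move=> v _; rewrite -sum1_count big_mkcond/=.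
  by apply: eq_bigr => w _; case: eqP.
apply: (@le_trans _ _ ((size vs)%:R * b)); last first.
  by rewrite ler_wpM2r// Qa// undup_uniq.
rewrite natr_sum -sum1_size natr_sum mulr_suml big_seq [leRHS]big_seq.
apply: ler_sum => v vvs; rewrite mul1r -size_filter.
apply: (fib v (vsQ v vvs)); first exact: filter_uniq.
by move=> w; rewrite mem_filter => /andP[/eqP gw /wsP].
Qed.

(* Lexicographic negativity of the pair [(a c, b c)]. *)
Lemma small_perturbation {F : finType} (P : F -> Prop) (a b : F -> R) :
  (forall c, P c -> a c < 0 \/ a c = 0 /\ b c < 0) ->
  exists2 e0 : R, 0 < e0 & forall e, 0 < e -> e <= e0 ->
    forall c, P c -> a c + e * b c < 0.
Proof.
move=> h; suff one c : exists2 e0 : R, 0 < e0 & forall e, 0 < e -> e <= e0 ->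
    P c -> a c + e * b c < 0.
  pose r c := sval (cid2 (one c)).
  exists (\big[Num.min/1]_c r c).
    by apply: lt_bigmin => // c _; rewrite /r; case: cid2.
  move=> e e_gt0 ee0 c; apply: (svalP (cid2 (one c))).2 => //.
  by apply: le_trans ee0 _; exact: bigmin_le.
have [/h|nP] := pselect (P c); last by exists 1.
case=> [a0|[-> b0]]; last first.
  by exists 1 => // e e0 _ _; rewrite add0r pmulr_rlt0.
have b1 : 0 < `|b c| + 1 by rewrite ltr_wpDl.
exists (- a c / (`|b c| + 1)); first by rewrite divr_gt0// oppr_gt0.
move=> e e0 + _; rewrite ler_pdivlMr// => ee0.
have := ler_wpM2l (ltW e0) (ler_norm (b c)); lra.
Qed.

End Counting.

(** * The quotient by a line, realized by eliminating a coordinate *)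

Section Elimination.
Context {R : realType} {d : nat}.
Local Notation V := 'cV[R]_d.

Definition max_coord (u : V) : option 'I_d := [pick i | `|u i 0| == `|u|].

(** The projection along [u] onto the hyperplane where a coordinate of [u] vanishes. Taking a
    coordinate of largest modulus keeps its norm at most 2. The branch [0] never occurs for nonzero
    [u]. *)
Definition elim_mx (u : V) : 'M[R]_d :=
  if max_coord u is Some i then 1%:M - (u i 0)^-1 *: (u *m delta_mx 0 i)
  else 0.

Definition elim_supp (u : V) (S : {set 'I_d}) : {set 'I_d} :=
  if max_coord u is Some i then S :\ i else S.

Lemma elim_mxP (u : V) : u != 0 -> exists i, [/\ u i 0 != 0,
  forall S, elim_supp u S = S :\ i,
  `|u i 0| = `|u| & forall x, elim_mx u *m x = x - (x i 0 / u i 0) *: u].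
Proof.
move=> u0; rewrite /elim_supp /elim_mx /max_coord.
case: pickP => [i /eqP ui|none]; last first.
  by have [i /eqP] := norm_coord_attained u0; rewrite none.
exists i; split => //; first by rewrite -normr_eq0 ui normr_eq0.
move=> x; rewrite mulmxBl mul1mx -scalemxAl -mulmxA -rowE; congr (_ - _).
rewrite mulrC -scalerA; congr (_ *: _); apply/matrixP => j k.
by rewrite (ord1 k) !mxE big_ord1 !mxE mulrC.
Qed.

Lemma elim_mx_eq0 (u x : V) : u != 0 ->
  elim_mx u *m x = 0 <-> exists t, x = t *: u.
Proof.
move=> u0; have [i [ui _ _ ->]] := elim_mxP u0; split => [/subr0_eq->|[t ->]].
  by eexists.
by rewrite mxE mulfK// subrr.
Qed.

Lemma elim_mx_norm (u x : V) : u != 0 -> `|elim_mx u *m x| <= 2 * `|x|.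
Proof.
move=> u0; have [i [ui _ uiE ->]] := elim_mxP u0.
rewrite mulr_natl mulr2n (le_trans (ler_normB _ _))// lerD2l normrZ.
by rewrite normrM normfV uiE mulfVK ?normr_eq0// coord_le_norm.
Qed.

Lemma elim_mx_supp (u x : V) (S : {set 'I_d}) : u != 0 ->
  (forall j, j \notin S -> u j 0 = 0) -> (forall j, j \notin S -> x j 0 = 0) ->
  forall j, j \notin elim_supp u S -> (elim_mx u *m x) j 0 = 0.
Proof.
move=> u0 uS xS j; have [i [ui -> _ ->]] := elim_mxP u0.
rewrite !inE negb_and negbK !mxE => /orP[/eqP->|jS].
  by rewrite mulfVK// subrr.
by rewrite (uS j)// (xS j)// mulr0 subrr.
Qed.

Lemma elim_supp_card (u : V) (S : {set 'I_d}) m : u != 0 ->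
  (forall j, j \notin S -> u j 0 = 0) ->
  (#|S| <= m.+1)%N -> (#|elim_supp u S| <= m)%N.
Proof.
move=> u0 uS; have [i [ui -> _ _]] := elim_mxP u0.
have iS : i \in S by apply: contraT => /uS /eqP; rewrite (negPf ui).
by rewrite (cardsD1 i S) iS.
Qed.

End Elimination.

(** * Systems of tangent cones and refinement of their flags *)

Section ConeSystems.
Context {R : realType} {d : nat} {I C : finType}.
Local Notation V := 'cV[R]_d.
Variables (cf : C -> 'rV[R]_d) (A : I -> 'M[R]_d).

Definition ev (c : 'rV[R]_d) (x : V) : R := (c *m x) 0 0.

Lemma evD c x y : ev c (x + y) = ev c x + ev c y.
Proof. by rewrite /ev mulmxDr mxE. Qed.

Lemma evZ c t x : ev c (t *: x) = t * ev c x.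
Proof. by rewrite /ev -scalemxAr mxE. Qed.

Lemma evB c x y : ev c (x - y) = ev c x - ev c y.
Proof. by rewrite evD -scaleN1r evZ mulN1r. Qed.

Lemma ev_mul c B x : ev (c *m B) x = ev c (B *m x).
Proof. by rewrite /ev mulmxA. Qed.

(* A state stands for a base point with a flag of tangent directions: letter
   [i] is admissible if the flag is adherent to the piece [i], whose tangent
   cone along the flag is cut out by the active constraints. The kernel of
   [proj s] is the span of the flag and its range lies in the coordinate
   subspace [supp s]. *)
Record cone_system := ConeSystem {
  state : Type;
  adm : state -> I -> Prop;
  act : state -> I -> C -> Prop;
  next : state -> I -> state;
  proj : state -> 'M[R]_d;
  supp : state -> {set 'I_d}
}.

(** The first letter acts first, so this is the linear part of the iterate along [w]. *)
Fixpoint prodA (w : seq I) : 'M[R]_d :=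
  if w is i :: w' then prodA w' *m A i else 1%:M.

Definition run (S : cone_system) (s : state S) (w : seq I) : state S :=
  foldl (@next S) s w.

(** [x] is a further tangent direction: being strictly negative on the active constraints means that
    a small move along [x] enters the open piece. *)
Fixpoint realizes (S : cone_system) (s : state S) (w : seq I) (x : V) : Prop :=
  if w is i :: w' then
    [/\ adm s i, forall c, act s i c -> ev (cf c) x < 0 &
        realizes (next s i) w' (A i *m x)]
  else True.

Definition realized (S : cone_system) (s : state S) (n : nat) (w : seq I) :=
  size w = n /\ exists x, realizes s w x.

(** [m] bounds the dimension transverse to the flag and [D] the norm of the projections. The last
    field bounds the condition number of realized products, written without inverses. *)
Record coherent (S : cone_system) (m : nat) (D : R) (kappa : nat -> R) : Prop :=
  Coherent {
  coh_disj : forall (s : state S) i j x, adm s i -> adm s j ->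
    (forall c, act s i c -> ev (cf c) x < 0) ->
    (forall c, act s j c -> ev (cf c) x < 0) -> i = j;
  coh_act : forall (s : state S) i c (x : V),
    act s i c -> proj s *m x = 0 -> ev (cf c) x = 0;
  coh_next : forall (s : state S) i (x : V),
    proj (next s i) *m (A i *m x) = 0 <-> proj s *m x = 0;
  coh_idem : forall (s : state S) (x : V), proj s *m (proj s *m x) = proj s *m x;
  coh_supp : forall (s : state S) (x : V) j,
    j \notin supp s -> (proj s *m x) j 0 = 0;
  coh_card : forall s : state S, (#|supp s| <= m)%N;
  coh_norm : forall (s : state S) (x : V), `|proj s *m x| <= D * `|x|;
  coh_cond : forall (s : state S) w x, realizes s w x -> forall y z : V,
    `|prodA w *m y| * `|z| <= kappa (size w) * (`|y| * `|prodA w *m z|)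
}.

Section Basic.
Variables (S : cone_system) (m : nat) (D : R) (kappa : nat -> R).
Hypothesis coh : coherent S m D kappa.
Implicit Types (s : state S) (w : seq I) (x y z : V).

Lemma realizes_cat s v w x : realizes s (v ++ w) x <->
  realizes s v x /\ realizes (run s v) w (prodA v *m x).
Proof.
elim: v s x => [|i v IHv] s x /=; first by rewrite mul1mx; split=> [|[]].
rewrite -mulmxA; split; first by case=> si sx /IHv[].
by case=> -[si sx sv] sw; split => //; apply/IHv.
Qed.

Lemma realizes_scale s w x t : 0 < t -> realizes s w x -> realizes s w (t *: x).
Proof.
move=> t0; elim: w s x => [//|i w IHw] s x /= [si sx /IHw wx]; split => //.
  by move=> c /sx cx; rewrite evZ pmulr_rlt0.
by rewrite -scalemxAr.
Qed.

Lemma proj_run_eq0 s w x :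
  proj (run s w) *m (prodA w *m x) = 0 <-> proj s *m x = 0.
Proof.
elim: w s x => [|i w IHw] s x /=; first by rewrite mul1mx.
rewrite -mulmxA; split=> [/IHw/(coh_next coh)//|h].
by apply/IHw; apply/(coh_next coh).
Qed.

Lemma proj_congr s x y : proj s *m x = proj s *m y -> proj s *m (x - y) = 0.
Proof. by move=> xy; rewrite mulmxBr xy subrr. Qed.

(** Active constraints vanish on the flag and the dynamics preserves flags, so only the class of a
    direction modulo the flag matters. *)
Lemma realizes_congr s w x y : proj s *m x = proj s *m y ->
  realizes s w x -> realizes s w y.
Proof.
elim: w s x y => [//|i w IHw] s x y xy /= [si sx wx]; split => //.
  move=> c sc; have := sx c sc; rewrite -[in X in X -> _](subrK y x) evD.
  by rewrite (coh_act coh sc (proj_congr xy)) add0r.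
apply: IHw wx; apply/subr0_eq; rewrite -!mulmxBr.
by apply/(coh_next coh); exact: proj_congr.
Qed.

Lemma realizes_proj s w x : realizes s w x -> realizes s w (proj s *m x).
Proof. by apply: realizes_congr; rewrite (coh_idem coh). Qed.

(** The zero vector satisfies no strict homogeneous inequality, so no constraint is active along
    [v]. Every direction then satisfies the constraints of [v], and disjointness forces equal
    letters. *)
Lemma realizes0_uniq s v w x : size v = size w ->
  realizes s v 0 -> realizes s w x -> v = w.
Proof.
elim: v w s x => [|i v IHv] [|j w] s x //= [vw] [si s0 v0] [sj sx wx].
have ij : i = j.
  apply: (coh_disj coh si sj (x := x)) => // c sc.
  by have := s0 c sc; rewrite -[0 : 'cV__](scale0r 0) evZ mul0r ltxx.
by subst j; congr cons; apply: IHv wx => //; rewrite mulmx0 in v0.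
Qed.

(** Constraints met at later times are pulled back to time zero, which turns realization into a
    single linear system. *)
Fixpoint active (s : state S) (w : seq I) (psi : 'rV[R]_d) : Prop :=
  if w is i :: w' then (exists2 c, act s i c & psi = cf c) \/
    (exists2 psi', active (next s i) w' psi' & psi = psi' *m A i)
  else False.

Fixpoint admissible (s : state S) (w : seq I) : Prop :=
  if w is i :: w' then adm s i /\ admissible (next s i) w' else True.

Lemma realizesE s w x : realizes s w x <->
  admissible s w /\ forall psi, active s w psi -> ev psi x < 0.
Proof.
elim: w s x => [|i w IHw] s x /=; first by split=> // _; split.
split=> [[si sx /IHw[aw wx]]|[[si aw] wx]].
  split=> // psi [[c sc ->]|[psi' /wx wpsi ->]]; first exact: sx.
  by rewrite ev_mul.
split=> //; first by move=> c sc; apply: wx; left; exists c.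
apply/IHw; split=> // psi wpsi; rewrite -ev_mul.
by apply: wx; right; exists psi.
Qed.

End Basic.

(** A finite list that depends on neither the system nor the state; this is the source of constants
    uniform in the base point and the flag. *)
Fixpoint pulled_constraints (p : nat) : seq 'rV[R]_d :=
  if p is p'.+1 then [seq cf c | c <- enum C] ++
    [seq psi *m A i | psi <- pulled_constraints p', i <- enum I] else [::].

Lemma active_pulled (S : cone_system) (s : state S) w psi p :
  (size w <= p)%N -> active s w psi -> psi \in pulled_constraints p.
Proof.
elim: w s psi p => [//|i w IHw] s psi [//|p] /= wp.
rewrite mem_cat => -[[c _ ->]|[psi' /IHw - /(_ p wp) psi'p ->]].
  by rewrite map_f// mem_enum.
by apply/orP; right; apply/allpairsP; exists (psi', i); rewrite mem_enum.
Qed.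

Section Derived.
Variables (S : cone_system) (m : nat) (D : R) (kappa : nat -> R).
Hypothesis coh : coherent S m.+1 D kappa.

Definition flag_state := {su : state S * V | proj su.1 *m su.2 != 0}.

Lemma flag_next_subproof (su : flag_state) i :
  proj (next (sval su).1 i) *m (A i *m (sval su).2) != 0.
Proof.
case: su => -[s u] /= su0; apply/eqP => /(coh_next coh)/eqP.
by rewrite (negPf su0).
Qed.

Definition flag_next (su : flag_state) i : flag_state :=
  exist _ (next (sval su).1 i, A i *m (sval su).2) (flag_next_subproof su i).

(* Refines the flag of a state by one more direction. *)
Definition derived : cone_system := {|
  state := flag_state;
  adm su i := adm (sval su).1 i /\
    forall c, act (sval su).1 i c -> ev (cf c) (sval su).2 <= 0;
  act su i c := act (sval su).1 i c /\ ev (cf c) (sval su).2 = 0;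
  next := flag_next;
  proj su := let u := proj (sval su).1 *m (sval su).2 in
    elim_mx u *m proj (sval su).1;
  supp su := let u := proj (sval su).1 *m (sval su).2 in
    elim_supp u (supp (sval su).1)
|}.

(** The flag direction decides every constraint on which it is nonzero, and [x] decides those on
    which it vanishes. *)
Lemma derived_ev_lt0 (su : state derived) i x : adm su i ->
  (forall c, act su i c -> ev (cf c) x < 0) ->
  exists2 e0 : R, 0 < e0 & forall e, 0 < e -> e <= e0 ->
    forall c, act (sval su).1 i c -> ev (cf c) ((sval su).2 + e *: x) < 0.
Proof.
case: su => -[s u] /= su0 [si su_le] x_lt.
have [c sc|e0 e0_gt0 e0P] := small_perturbation (P := act s i)
  (a := fun c => ev (cf c) u) (b := fun c => ev (cf c) x).
  have := su_le c sc; rewrite le_eqVlt => /orP[/eqP uc|]; last by left.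
  by right; split => //; exact: x_lt.
by exists e0 => // e e_gt0 ee0 c sc; rewrite evD evZ e0P.
Qed.

(** Brings realizations of the refined system back to the original one, whose condition number bound
    is thus inherited. *)
Lemma derived_realizes (su : state derived) w x : realizes su w x ->
  exists2 e0 : R, 0 < e0 & forall e, 0 < e -> e <= e0 ->
    realizes (sval su).1 w ((sval su).2 + e *: x).
Proof.
elim: w su x => [|i w IHw] su x /=; first by exists 1.
case=> -[si su_le] x_lt /IHw[e1 e1_gt0 e1P].
have [e2 e2_gt0 e2P] := derived_ev_lt0 (conj si su_le) x_lt.
exists (Num.min e1 e2) => [|e e_gt0]; first by rewrite lt_min e1_gt0.
rewrite le_min => /andP[ee1 ee2]; split => //; first exact: e2P.
by rewrite mulmxDr -scalemxAr; exact: e1P.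
Qed.

Lemma derived_proj_eq0 (su : state derived) x : proj su *m x = 0 <->
  exists t, proj (sval su).1 *m (x - t *: (sval su).2) = 0.
Proof.
case: su => -[s u] /= su0; rewrite -mulmxA.
split=> [/(elim_mx_eq0 _ su0)|] [t st]; last first.
  apply/(elim_mx_eq0 _ su0); exists t.
  by apply/subr0_eq; rewrite scalemxAr -mulmxBr.
by exists t; rewrite mulmxBr st -scalemxAr subrr.
Qed.

Lemma derived_coherent : coherent derived m (2 * D) kappa.
Proof.
split.
- move=> su i j x si sj ix jx.
  have [e1 e1_gt0 e1P] := derived_ev_lt0 si ix.
  have [e2 e2_gt0 e2P] := derived_ev_lt0 sj jx.
  apply: (coh_disj coh si.1 sj.1
    (x := (sval su).2 + Num.min e1 e2 *: x)).
    by apply: e1P; rewrite ?lt_min ?e1_gt0// ge_min lexx.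
  by apply: e2P; rewrite ?lt_min ?e1_gt0// ge_min lexx orbT.
- move=> su i c x [sc uc] /derived_proj_eq0[t st].
  by have := coh_act coh sc st; rewrite evB evZ uc mulr0 subr0.
- move=> su i x; split=> /derived_proj_eq0[t st]; apply/derived_proj_eq0;
    exists t; move: st => /=.
    by rewrite scalemxAr -mulmxBr => /(coh_next coh).
  by move=> st; rewrite scalemxAr -mulmxBr; apply/(coh_next coh).
- move=> su x; apply/subr0_eq; rewrite -mulmxBr; apply/derived_proj_eq0.
  case: su => -[s u] /= su0; have [i [_ _ _ eE]] := elim_mxP su0.
  (* Elimination subtracts this multiple of [proj s *m u]; modulo the kernel of [proj s] the defect
     is that multiple of [u], with opposite sign. *)
  exists (- ((proj s *m x) i 0 / (proj s *m u) i 0)).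
  rewrite -mulmxA eE scaleNr opprK !mulmxDr mulmxN (coh_idem coh).
  by rewrite mulmxN -!scalemxAr (coh_idem coh) [X in X + _]addrAC subrr add0r addNr.
- case=> -[s u] /= su0 x j js; rewrite -mulmxA.
  by apply: (elim_mx_supp su0 _ _ js) => k; exact: coh_supp coh _ _ _.
- case=> -[s u] /= su0; apply: (elim_supp_card su0) (coh_card coh s) => k.
  exact: coh_supp coh _ _ _.
- case=> -[s u] /= su0 x; rewrite -mulmxA.
  apply: le_trans (elim_mx_norm _ su0) _.
  by rewrite -mulrA ler_pM2l//; exact: coh_norm coh _ _.
- move=> su w x /derived_realizes[e0 e0_gt0 /(_ e0 e0_gt0 (lexx _))].
  exact: coh_cond coh _ _ _.
Qed.

End Derived.

End ConeSystems.

(** * Exponential growth of the number of realized words *)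

Section Growth.
Context {R : realType} {d : nat} {I C : finType}.
Local Notation V := 'cV[R]_d.
Variables (cf : C -> 'rV[R]_d) (A : I -> 'M[R]_d).
Hypothesis Aunit : forall i, A i \in unitmx.

Lemma prodA_unit w : prodA A w \in unitmx.
Proof.
by elim: w => [|i w IHw] /=; rewrite ?unitmx1// unitmx_mul IHw Aunit.
Qed.

Lemma approx_solution_seq (L : seq 'rV[R]_d) (rho : R) : 0 < rho ->
  exists2 r : R, 0 < r & forall (Q : 'rV[R]_d -> Prop) (u : V), `|u| <= 1 ->
    (forall psi, psi \in L -> Q psi -> ev psi u <= r) ->
    exists2 v : V, `|u - v| < rho &
      forall psi, psi \in L -> Q psi -> ev psi v <= 0.
Proof.
move=> /(approx_solution (fun k : 'I_(size L) => nth 0 L k))[r r0 rP].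
exists r => // Q u u1 uQ.
have [k|v uv vP] := rP [set k : 'I_(size L) | `[< Q (nth 0 L k) >]]%SET u u1.
  by rewrite inE => /asboolP; apply: uQ; exact: mem_nth.
exists v => // psi psiL Qpsi.
have kL : (index psi L < size L)%N by rewrite index_mem.
have := vP (Ordinal kL); rewrite inE /= nth_index//; apply; exact/asboolP.
Qed.

Lemma ev_bound (L : seq 'rV[R]_d) : exists2 B : R, 0 <= B &
  forall psi (x : V), psi \in L -> ev psi x <= B * `|x|.
Proof.
elim: L => [|psi L [B B0 BP]]; first by exists 0.
have [B' B'0 B'P] := mulmx_norm_le psi.
exists (B + B') => [|phi x]; first exact: addr_ge0.
rewrite inE mulrDl => /orP[/eqP->|/BP/le_trans->//]; last first.
  by rewrite lerDl mulr_ge0.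
apply: le_trans (ler_norm _) _; apply: le_trans (coord_le_norm _ _) _.
by apply: le_trans (B'P x) _; rewrite lerDr mulr_ge0.
Qed.

Section Step.
Variables (S : @cone_system R d I C) (m : nat) (D : R) (kappa : nat -> R).
Hypothesis coh : coherent cf A S m.+1 D kappa.
Hypothesis D0 : 0 < D.
Local Notation S' := (derived coh).

(** Weak inequalities at the flag direction give admissibility. Strictness is asked only of
    constraints vanishing there, and [x] satisfies it for all active ones. *)
Lemma realizes_derived (su : state S') w x :
  realizes cf A (sval su).1 w x ->
  (forall psi, active cf A (sval su).1 w psi -> ev psi (sval su).2 <= 0) ->
  realizes cf A su w x.
Proof.
elim: w su x => [//|i w IHw] su x /= [si sx wx] act_le; split.
- by split=> // c sc; apply: act_le; left; exists c.
- by move=> c [/sx].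
- apply: IHw => //= psi wpsi; rewrite -ev_mul; apply: act_le.
  by right; exists psi.
Qed.

(* Realizing directions that are close enough are all realizing along a common
   direction: this is the Lebesgue number of a cover of the sphere. *)
Lemma common_flag p : exists2 r : R, 0 < r &
  forall (s : state S) p' (Y : seq I -> V -> Prop), (p' <= p)%N ->
    (forall b y, Y b y ->
      [/\ size b = p', realizes cf A s b y, proj s *m y = y & `|y| = 1]) ->
    (forall b b' y y', Y b y -> Y b' y' -> `|y - y'| <= r) ->
    (exists b y, Y b y) ->
    exists su : state S', forall b y, Y b y -> realizes cf A su b y.
Proof.
pose L := pulled_constraints cf A p.
(* The tolerance [D^-1] keeps [proj s *m v] nonzero: [proj s] fixes the unit vector [y0] and expands
   by at most [D]. *)
have [|r0 r0_gt0 r0P] := @approx_solution_seq L D^-1; first by rewrite invr_gt0.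
have [B B0 BP] := ev_bound L.
have B1 : 0 < B + 1 by rewrite ltr_wpDl.
(* Constraints negative at a vector within this distance of [y0] are at most [r0] at [y0], since [B]
   bounds their growth. *)
exists (r0 / (B + 1)); first exact: divr_gt0.
move=> s p' Y p'p Yreal Yclose [b0 [y0 Y0]].
have [_ _ Py0 y01] := Yreal _ _ Y0.
pose Q psi := exists b y, Y b y /\ active cf A s b psi.
have [|psi psiL [b [y [Yby bpsi]]]|v y0v vP] := r0P Q y0; first by rewrite y01.
  have [_ /realizesE[_ /(_ _ bpsi) y_lt0] _ _] := Yreal _ _ Yby.
  rewrite -(subrK y y0) evD -[leRHS]addr0 lerD//; last exact: ltW.
  apply: le_trans (BP _ _ psiL) _.
  apply: le_trans (ler_wpM2l B0 (Yclose _ _ _ _ Y0 Yby)) _.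
  rewrite mulrCA ger_pMr// ler_pdivrMr//; lra.
have su0 : proj s *m v != 0.
  apply/eqP => v0; have := coh_norm coh s (y0 - v).
  rewrite mulmxBr v0 subr0 Py0 y01 => h.
  by move: y0v; rewrite -[D^-1]mul1r ltr_pdivlMr// mulrC ltNge h.
exists (exist _ (s, v) su0) => b y Yby.
have [bp' by_real _ _] := Yreal _ _ Yby.
apply: realizes_derived => //= psi bpsi; apply: vP; last by exists b, y.
by apply: active_pulled bpsi; rewrite bp'.
Qed.

Definition normalize (y : V) : V := `|y|^-1 *: y.

Lemma norm_normalize y : y != 0 -> `|normalize y| = 1.
Proof. by move=> y0; rewrite normrZ normfV normr_id mulVf ?normr_eq0. Qed.

(** The difference splits into a change of position and a change of radius, each at most the
    distance divided by the norm of [y]. *)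
Lemma normalize_dist y z : y != 0 -> z != 0 ->
  `|normalize y - normalize z| <= 2 * (`|y - z| / `|y|).
Proof.
move=> y0 z0; have yn : `|y| != 0 by rewrite normr_eq0.
have zn : `|z| != 0 by rewrite normr_eq0.
have -> : normalize y - normalize z =
    `|y|^-1 *: (y - z) + (`|y|^-1 - `|z|^-1) *: z.
  by rewrite scalerBr scalerBl addrA subrK.
apply: le_trans (ler_normD _ _) _; rewrite !normrZ mulr_natl mulr2n.
rewrite normfV normr_id [leLHS]addrC mulrC [X in _ + X]mulrC lerD2r.
rewrite -[X in X * _]normr_id -normrM.
have -> : `|z| * (`|y|^-1 - `|z|^-1) = (`|z| - `|y|) / `|y|.
  by rewrite mulrBr mulrBl !divff.
by rewrite normrM normfV normr_id ler_wpM2r// distrC ler_dist_dist.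
Qed.

Definition dir (s : state S) (v : seq I) (x : V) : V :=
  normalize (proj (run s v) *m (prodA A v *m x)).

(** The condition number compares the expansion of [x - x'] with that of a lift of [x]. The two
    projections cost a factor [D] each and normalization costs the 2. *)
Lemma dir_dist (s : state S) v x x' z : realizes cf A s v z ->
  proj s *m x = x -> `|x| = 1 -> proj s *m x' = x' -> x' != 0 ->
  `|dir s v x - dir s v x'| <= 2 * (D ^+ 2 * kappa (size v)) * `|x - x'|.
Proof.
move=> vz Px x1 Px' x'0.
have nz (u : V) : proj s *m u = u -> u != 0 ->
    proj (run s v) *m (prodA A v *m u) != 0.
  move=> Pu u0; apply/eqP => /(proj_run_eq0 coh)/eqP.
  by rewrite Pu (negPf u0).
have x0 : x != 0 by rewrite -normr_eq0 x1 oner_neq0.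
set y := proj (run s v) *m (prodA A v *m x).
set y' := proj (run s v) *m (prodA A v *m x').
have y0 : y != 0 := nz _ Px x0.
have := normalize_dist y0 (nz _ Px' x'0).
rewrite -/(dir s v x) -/y' -/(dir s v x') => /le_trans; apply.
rewrite -!mulrA ler_pM2l// ler_pdivrMr ?normr_gt0//.
(* Projection may shrink [prodA A v *m x], so [x] itself is no good for comparison. The lift [u] is
   mapped exactly onto [y], and [proj s *m u = x] keeps its norm at least [D^-1]. *)
pose u := invmx (prodA A v) *m y.
have Au : prodA A v *m u = y by rewrite mulKVmx// prodA_unit.
have Pu : proj s *m u = x.
  rewrite -[RHS]Px; apply/subr0_eq; rewrite -mulmxBr.
  apply/(proj_run_eq0 coh s v).
  by rewrite 2!mulmxBr Au /y (coh_idem coh) subrr.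
have u1 : 1 <= D * `|u| by rewrite -x1 -{1}Pu; exact: coh_norm coh _ _.
have yy' : `|y - y'| <= D * `|prodA A v *m (x - x')|.
  by rewrite /y /y' -!mulmxBr; exact: coh_norm coh _ _.
have /(ler_wpM2l (ltW (exprn_gt0 2 D0))) := coh_cond coh vz (x - x') u.
rewrite Au -!mulrA; apply: le_trans; apply: le_trans yy' _.
by rewrite ler_pM2l// mulrCA -[leLHS]mulr1 ler_wpM2l.
Qed.

(** Induction on the number of blocks: over a fixed prefix the directions are close, so the next
    blocks are all realized along one common flag, which leaves at most [M] of them. *)
Lemma block_count p (M r : R) : 1 <= M ->
  (forall (su : state S') p', (p' <= p)%N -> card_le (realized cf A su p') M) ->
  (forall (s : state S) p' (Y : seq I -> V -> Prop), (p' <= p)%N ->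
    (forall b y, Y b y ->
      [/\ size b = p', realizes cf A s b y, proj s *m y = y & `|y| = 1]) ->
    (forall b b' y y', Y b y -> Y b' y' -> `|y - y'| <= r) ->
    (exists b y, Y b y) ->
    exists su : state S', forall b y, Y b y -> realizes cf A su b y) ->
  forall (s : state S) n (P : seq I -> Prop) (x : seq I -> V),
    (forall w, P w -> [/\ size w = n, realizes cf A s w (x w) &
       proj s *m x w != 0]) ->
    (forall k w w', P w -> P w' -> take k w = take k w' ->
       `|dir s (take k w) (x w) - dir s (take k w) (x w')| <= r) ->
  forall j, card_le (fun v => exists2 w, P w & take (j * p) w = v) (M ^+ j).
Proof.
move=> M1 Mcount common s n P x Preal Pclose; elim=> [|j IHj].
  rewrite expr0 mul0n; apply: card_le1 => // v w [? _ <-] [? _ <-].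
  by rewrite !take0.
rewrite exprSr; apply: (card_le_fiber (g := take (j * p))) IHj _ _.
- exact: le_trans ler01 M1.
- move=> _ [w Pw <-]; exists w => //.
  by rewrite take_takel// leq_mul2r leqnSn orbT.
move=> v0 _.
pose Q b := exists2 w, P w /\ take (j * p) w = v0 & take p (drop (j * p) w) = b.
suff Qcount : card_le Q M.
  apply: (card_le_inj (g := drop (j * p))) Qcount _ _.
    move=> _ [[w Pw <-] wv0]; exists w; last by rewrite take_drop mulSn.
    by split=> //; rewrite -wv0 take_takel// leq_mul2r leqnSn orbT.
  move=> v w [_ vv0] [_ wv0] vw.
  by rewrite -(cat_take_drop (j * p) v) vv0 -wv0 vw cat_take_drop.
pose Y b y := exists2 w, P w /\ take (j * p) w = v0 &
  take p (drop (j * p) w) = b /\ y = dir s v0 (x w).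
have [[b0 [y0 Y0]]|nY] := pselect (exists b y, Y b y); last first.
  apply: card_le1 => // v v' [w Pw bw] _; exfalso; apply: nY.
  by exists v, (dir s v0 (x w)), w.
(* The last block may be shorter than [p], or empty; hence the minimum. *)
have [||||su suP] := common (run s v0) (minn p (n - j * p)) Y.
- exact: geq_minl.
- move=> _ _ [w [Pw wv0] [<- ->]]; have [wn wx Px0] := Preal _ Pw.
  have nz : proj (run s v0) *m (prodA A v0 *m x w) != 0.
    by apply/eqP => /(proj_run_eq0 coh)/eqP; rewrite (negPf Px0).
  split.
  + by rewrite size_take_min size_drop wn.
  + have wE : w = v0 ++ take p (drop (j * p) w) ++ drop p (drop (j * p) w).
      by rewrite cat_take_drop -wv0 cat_take_drop.
    move: wx; rewrite {1}wE => /realizes_cat[_ /realizes_cat[+ _]].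
    move=> /(realizes_proj coh); rewrite /dir /normalize.
    apply: realizes_scale.
    by rewrite invr_gt0 normr_gt0.
  + by rewrite /dir /normalize -scalemxAr (coh_idem coh).
  + exact: norm_normalize.
- move=> _ _ _ _ [w [Pw wv0] [_ ->]] [w' [Pw' w'v0] [_ ->]].
  by have := Pclose (j * p)%N w w' Pw Pw'; rewrite wv0 w'v0; apply.
- by exists b0, y0.
move=> bs ubs bsQ; apply: (Mcount su (minn p (n - j * p)) (geq_minl _ _) bs ubs).
move=> b /bsQ[w [Pw wv0] wb]; split.
  by have [wn _ _] := Preal _ Pw; rewrite -wb size_take_min size_drop wn.
by exists (dir s v0 (x w)); apply: suP; exists w.
Qed.

End Step.

(** Cells of side [delta] in the cube of side 2. Coordinates outside [S] get a fixed value, so the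
    exponent in the number of cells is the cardinality of [S]. *)
Definition grid (L : nat) (delta : R) (S : {set 'I_d}) (x : V) :
    {ffun 'I_d -> 'I_L.+1} :=
  [ffun j => if j \in S then inord (Num.trunc ((x j 0 + 1) / delta)) else ord0].

Lemma grid_dist (L : nat) (delta : R) (S : {set 'I_d}) (x y : V) : 0 < delta ->
  2 / delta < L.+1%:R -> `|x| <= 1 -> `|y| <= 1 ->
  (forall j, j \notin S -> x j 0 = y j 0) ->
  grid L delta S x = grid L delta S y -> `|x - y| <= delta.
Proof.
move=> delta0 deltaL x1 y1 xyS /ffunP xy; apply: norm_le_coord => [|j].
  exact: ltW.
rewrite !mxE; have [jS|/xyS->] := boolP (j \in S); last first.
  by rewrite subrr normr0 ltW.
have cell (u : V) : `|u| <= 1 -> (u j 0 + 1) / delta >= 0 /\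
    (Num.trunc ((u j 0 + 1) / delta)%R < L.+1)%N.
  move=> u1; have := le_trans (coord_le_norm u j) u1.
  rewrite ler_norml => /andP[u_ge u_le].
  have u0 : 0 <= (u j 0 + 1) / delta by rewrite divr_ge0 ?(ltW delta0)//; lra.
  split=> //; rewrite truncn_lt_nat//; apply: le_lt_trans deltaL.
  rewrite ler_pM2r ?invr_gt0//; lra.
have [x0 xL] := cell _ x1; have [y0 yL] := cell _ y1.
have := xy j; rewrite !ffunE jS => /(congr1 val); rewrite /= !inordK// => xyE.
have := truncn_itv y0; have := truncn_itv x0; rewrite xyE.
set k := Num.trunc _; rewrite -natr1 => /andP[kx xk] /andP[ky yk].
rewrite -[x j 0 - y j 0](divfK (lt0r_neq0 delta0)) normrM (gtr0_norm delta0).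
rewrite ger_pMl// ler_norml.
have -> : (x j 0 - y j 0) / delta = (x j 0 + 1) / delta - (y j 0 + 1) / delta.
  by rewrite -mulrBl; congr (_ / _); lra.
by apply/andP; split; lra.
Qed.

(** The constant [c] is chosen before the state; this uniformity allows one block length for all
    flags. *)
Definition growth_le (S : @cone_system R d I C) (h : R) : Prop :=
  forall eta, 0 < eta -> exists2 c : R, 1 <= c &
    forall (s : state S) n,
      card_le (realized cf A s n) (c * expR (n%:R * (h + eta))).

Variables (K lam : R).
Hypotheses (K1 : 1 <= K) (lam0 : 0 <= lam).
Let kappa n : R := K * expR (n%:R * lam).

Let kappa_ge1 n : 1 <= kappa n.
Proof.
by rewrite mulr_ege1// -expR0 ler_expR mulr_ge0.
Qed.

(* A grid of mesh about [1 / kappa n] sorts the realizing directions; within a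
   cell, words are counted in blocks of length [p], each along a common flag. *)
Lemma growth_step (S : @cone_system R d I C) m D E
    (coh : coherent cf A S m.+1 D kappa) : 0 < D -> 0 <= E ->
  growth_le (derived coh) E -> growth_le S (E + m%:R * lam).
Proof.
move=> D0 E0 growth' eta eta0.
have eta2 : 0 < eta / 2 by rewrite divr_gt0.
have [c c1 cP] := growth' _ eta2.
(* Blocks are long enough for the constant [c] to cost a rate of at most [eta / 2]. *)
pose p := (Num.trunc (ln c / (eta / 2))).+1.
have c_le : c <= expR (p%:R * (eta / 2)).
  rewrite -[c]lnK ?posrE ?(lt_le_trans ltr01)// ler_expR -ler_pdivrMr//.
  exact/ltW/truncnS_gt.
pose h := E + eta.
have h0 : 0 <= h by rewrite addr_ge0// ltW.
pose M := expR (p%:R * h).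
have M1 : 1 <= M by rewrite -expR0 ler_expR mulr_ge0.
have Mcount (su : state (derived coh)) p' : (p' <= p)%N ->
    card_le (realized cf A su p') M.
  move=> p'p; apply: card_le_weak (cP su p') _.
  have -> : M = expR (p%:R * (eta / 2)) * expR (p%:R * (E + eta / 2)).
    by rewrite -expRD -mulrDr /M /h; congr (expR (_ * _)); lra.
  apply: ler_pM => //; rewrite ?expR_ge0// ?(le_trans ler01)//.
  by rewrite ler_expR ler_wpM2r ?ler_nat// addr_ge0// ltW.
have [r r0 rP] := common_flag coh D0 p.
pose c1' := 4 * D ^+ 2 / r + 1.
have D20 : 0 < D ^+ 2 by rewrite exprn_gt0.
have c1'0 : 0 <= c1' by rewrite addr_ge0// divr_ge0 ?mulr_ge0// ltW.
pose B : R := #|{: option 'I_d * bool}|%:R.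
exists (1 + B * ((c1' * K) ^+ m * M)).
  by rewrite lerDl !mulr_ge0 ?exprn_ge0 ?mulr_ge0 ?expR_ge0// (le_trans ler01).
move=> s n.
have exp1 : 1 <= expR (n%:R * (E + m%:R * lam + eta)).
  by rewrite -expR0 ler_expR mulr_ge0// !addr_ge0 ?mulr_ge0// ltW.
have cst0 : 0 <= B * ((c1' * K) ^+ m * M).
  by rewrite !mulr_ge0 ?exprn_ge0 ?mulr_ge0 ?expR_ge0// (le_trans ler01).
(* If the zero direction realizes a word, that word is the only realized one of length [n].
   Otherwise realizing directions have nonzero projections and can be normalized. *)
have [[v [vn v0]]|n0] :=
    pselect (exists v, size v = n /\ realizes cf A s v 0).
  apply: card_le1 => [|w w' [wn [x wx]] [w'n [x' w'x']]].
    by rewrite mulr_ege1// lerDl.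
  have <- := realizes0_uniq coh (etrans vn (esym wn)) v0 wx.
  by have <- := realizes0_uniq coh (etrans vn (esym w'n)) v0 w'x'.
have /choice[x xP] : forall w, exists x : V, realized cf A s n w ->
    [/\ realizes cf A s w x, proj s *m x = x & `|x| = 1].
  move=> w.
  have [[wn [x wx]]|nw] := pselect (realized cf A s n w); last by exists 0.
  have Px := realizes_proj coh wx.
  have Px0 : proj s *m x != 0.
    by apply/eqP => Px0; apply: n0; exists w; rewrite -Px0.
  exists (normalize (proj s *m x)) => _; split.
  - by apply: realizes_scale Px; rewrite invr_gt0 normr_gt0.
  - by rewrite -scalemxAr (coh_idem coh).
  - exact: norm_normalize.
(* With this mesh [dir_dist] keeps directions of one cell within [r] at all times up to [n]. *)
pose delta := r / (2 * (D ^+ 2 * kappa n)).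
have kappa0 k : 0 < kappa k by apply: lt_le_trans (kappa_ge1 k); exact: ltr01.
have delta0 : 0 < delta.
  by apply: divr_gt0 => //; apply: mulr_gt0 => //; apply: mulr_gt0.
pose L := Num.trunc (2 / delta).
have deltaE : 2 / delta = 4 * D ^+ 2 / r * kappa n.
  rewrite /delta; have := kappa0 n; move: (kappa n) => k k0.
  by field; rewrite !lt0r_neq0.
have L_le : L.+1%:R <= c1' * kappa n.
  rewrite -natr1 (@le_trans _ _ (2 / delta + 1))// ?lerD2r.
    by rewrite truncn_le divr_ge0// ltW.
  by rewrite deltaE [leRHS](mulrDl _ 1) mul1r lerD2l.
pose q := (n %/ p).+1.
have nq : (n <= q * p)%N by rewrite ltnW// -ltn_divLR.
(* Unit vectors are sorted by a coordinate of modulus one and its sign. That coordinate becomes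
   constant, so the grid needs only [m] coordinates instead of [m.+1]. *)
pose g w := (max_coord (x w),
  if max_coord (x w) is Some i then 0 <= x w i 0 else true).
apply: (@card_le_weak _ _ _ (B * ((L.+1 ^ m)%:R * M ^+ q))).
  apply: (card_le_fiber (g := g) (Q := fun=> True)) => //.
  - by rewrite mulr_ge0// exprn_ge0// (le_trans ler01).
  - exact: card_le_finType.
  have M_ge1 : 1 <= M ^+ q by rewrite exprn_ege1.
  have bound1 : 1 <= (L.+1 ^ m)%:R * M ^+ q.
    by rewrite mulr_ege1// natrX exprn_ege1// ler1n.
  have attained w i : realized cf A s n w -> max_coord (x w) = Some i ->
      `|x w i 0| = 1.
    move=> /xP[_ _ x1]; rewrite /max_coord; case: pickP => // j /eqP.
    by rewrite x1 => xj [<-].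
  have in_supp w i : realized cf A s n w -> max_coord (x w) = Some i ->
      i \in supp s.
    move=> wr wi; have := attained _ _ wr wi; have [_ Px _] := xP _ wr.
    apply: contra_eqT => is'; rewrite -Px (coh_supp coh)// normr0.
    by rewrite eq_sym oner_neq0.
  case=> -[i|] b _; last first.
    apply: card_le1 => // w w' [/xP[_ _ x1] [/esym wi _]]; exfalso.
    move: wi; rewrite /max_coord; case: pickP => // none.
    have x0 : x w != 0 by rewrite -normr_eq0 x1 oner_neq0.
    by have [i /eqP] := norm_coord_attained x0; rewrite none.
  have [iS|iS] := boolP (i \in supp s); last first.
    apply: card_le1 => // w w' [wr [wi _]]; exfalso.
    by move: iS; rewrite (in_supp _ _ wr wi).
  apply: (card_le_fiber (g := fun w => grid L delta (supp s :\ i) (x w))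
    (Q := fun f => f \in pffun_on ord0 (mem (supp s :\ i)) predT)).
  - by rewrite exprn_ge0// (le_trans ler01).
  - apply: card_le_weak (card_le_finType
      (D := pffun_on ord0 (mem (supp s :\ i)) predT) _) _ => //.
    rewrite card_pffun_on cardT size_enum_ord ler_nat leq_pexp2l//.
    by have := coh_card coh s; rewrite (cardsD1 i) iS.
  - move=> w _; apply/pffun_onP; split=> //.
    apply/fintype.subsetP => j; rewrite inE ffunE.
    by case: ifP => //; rewrite eqxx.
  move=> f _; pose P w := (realized cf A s n w /\ g w = (Some i, b)) /\
    grid L delta (supp s :\ i) (x w) = f.
  change (card_le P (M ^+ q)).
  have Preal w : P w -> [/\ size w = n, realizes cf A s w (x w) &
      proj s *m x w != 0].
    move=> [[wr _] _]; have [wx Px x1] := xP _ wr; split=> //; first exact: wr.1.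
    by rewrite Px -normr_eq0 x1 oner_neq0.
  have Pclose w w' : P w -> P w' -> `|x w - x w'| <= delta.
    move=> [[wr [wi wb]] wf] [[w'r [w'i w'b]] w'f].
    have [_ Px x1] := xP _ wr; have [_ Px' x'1] := xP _ w'r.
    apply: (grid_dist delta0 (truncnS_gt _)) (etrans wf (esym w'f)).
    - by rewrite x1.
    - by rewrite x'1.
    move=> j; rewrite !inE negb_and negbK => /orP[/eqP->|jS]; last first.
      by rewrite -Px -Px' !(coh_supp coh).
    have := attained _ _ wr wi; have := attained _ _ w'r w'i.
    move: wb w'b; rewrite wi w'i => <-.
    move: (x w i 0) (x w' i 0) => a a' sgn.
    case: (ger0P a) sgn => _; case: (ger0P a') => _ //= _.
      by move=> -> ->.
    by move=> <- /oppr_inj.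
  have Pdir k w w' : P w -> P w' -> take k w = take k w' ->
      `|dir s (take k w) (x w) - dir s (take k w) (x w')| <= r.
    move=> Pw Pw' _; have [wn wx Px0] := Preal _ Pw.
    have [_ Px x1] := xP _ Pw.1.1; have [_ Px' x'1] := xP _ Pw'.1.1.
    have x'0 : x w' != 0 by rewrite -normr_eq0 x'1 oner_neq0.
    move: wx; rewrite -{1}(cat_take_drop k w) => /realizes_cat[kx _].
    apply: le_trans (dir_dist coh D0 kx Px x1 Px' x'0) _.
    have kn : kappa (size (take k w)) <= kappa n.
      rewrite /kappa ler_pM2l ?(lt_le_trans ltr01)// ler_expR ler_wpM2r//.
      by rewrite ler_nat size_take_min wn geq_minr.
    have -> : r = 2 * (D ^+ 2 * kappa n) * delta.
      by rewrite mulrC divfK// lt0r_neq0// mulr_gt0// mulr_gt0.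
    apply: ler_pM => //; last exact: Pclose.
      by rewrite mulr_ge0// mulr_ge0 ?ltW.
    by rewrite ler_pM2l// ler_pM2l.
  have Pcount :=
    @block_count S m D kappa coh p M r M1 Mcount rP s n P x Preal Pdir q.
  apply: (card_le_inj (g := id) Pcount).
    move=> w Pw; exists w => //; have [wn _ _] := Preal _ Pw.
    by rewrite take_oversize// wn.
  by [].
have LE : (L.+1 ^ m)%:R <= (c1' * K) ^+ m * expR (n%:R * (m%:R * lam)).
  rewrite [n%:R * _]mulrCA expRM_natl -exprMn natrX lerXn2r ?nnegrE//.
    by rewrite -mulrA; exact: mulr_ge0 c1'0 (ltW (kappa0 n)).
  by rewrite -mulrA.
(* The [q] blocks have total length at most [n + p]; the excess costs one factor [M]. *)
have ME : M ^+ q <= M * expR (n%:R * h).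
  rewrite -expRM_natr -expRD ler_expR mulrAC -mulrDl ler_wpM2r//.
  by rewrite -natrM -natrD ler_nat mulnS leq_add2l mulnC leq_trunc_div.
have -> : n%:R * (E + m%:R * lam + eta) = n%:R * (m%:R * lam) + n%:R * h.
  by rewrite /h; ring.
rewrite expRD; apply: (@le_trans _ _ (B * ((c1' * K) ^+ m * M) *
    (expR (n%:R * (m%:R * lam)) * expR (n%:R * h)))); last first.
  by rewrite ler_wpM2r ?mulr_ge0 ?expR_ge0// lerDr.
rewrite -!mulrA ler_wpM2l// mulrA mulrACA -mulrA.
rewrite [leRHS](_ : _ = ((c1' * K) ^+ m * expR (n%:R * (m%:R * lam))) *
  (M * expR (n%:R * h))); last by ring.
by apply: ler_pM => //; rewrite exprn_ge0// (le_trans ler01).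
Qed.

(** Induction on the transverse dimension. At [m = 0] the projections vanish, so every realized word
    is realized by zero and is unique. The step adds [m%:R * lam], matching Pascal's rule for
    ['C(m.+1, 2)]. *)
Lemma growth_bound m (S : @cone_system R d I C) D :
  coherent cf A S m D kappa -> 0 < D -> growth_le S ('C(m, 2)%:R * lam).
Proof.
elim: m S D => [|m IHm] S D coh D0.
  move=> eta eta0; exists 1 => // s n; rewrite mul0r add0r mul1r.
  apply: card_le1 => [|v w [vn [x vx]] [wn [y wy]]].
    by rewrite -expR0 ler_expR mulr_ge0// ltW.
  apply: (realizes0_uniq coh (etrans vn (esym wn)) _ wy).
  apply: (realizes_congr coh _ vx); rewrite mulmx0.
  apply/matrixP => i j; rewrite (ord1 j) (coh_supp coh) ?mxE//.
  by have := coh_card coh s; rewrite leqn0 cards_eq0 => /eqP->; rewrite inE.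
rewrite binS bin1 natrD mulrDl.
refine (growth_step (coh := coh) D0 _ _); first by rewrite mulr_ge0.
by apply: IHm (derived_coherent coh) _; rewrite mulr_gt0.
Qed.

End Growth.

(** * The cone system with empty flags over base points *)

Section InitialSystem.
Context {R : realType} {d : nat} {I C : finType}.
Local Notation V := 'cV[R]_d.
Variables (own : C -> I) (cf : C -> 'rV[R]_d) (bf : C -> R).
Variables (A : I -> 'M[R]_d) (b : I -> V).

(** The half-spaces of all pieces share one finite index type; [own c] names the piece that [c]
    bounds. *)
Definition piece (i : I) : set V :=
  [set x | forall c, own c = i -> ev (cf c) x < bf c].

Hypothesis piece_disj : forall i j x, piece i x -> piece j x -> i = j.
Hypothesis Aunit : forall i, A i \in unitmx.

Fixpoint itinerary (w : seq I) (x : V) : Prop :=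
  if w is i :: w' then piece i x /\ itinerary w' (A i *m x + b i) else True.

(** Weak inequalities let the base point lie on the boundary of a piece; the letter then selects
    which affine branch continues it. *)
Definition initial : @cone_system R d I C := {|
  state := V;
  adm a i := forall c, own c = i -> ev (cf c) a <= bf c;
  act a i c := own c = i /\ ev (cf c) a = bf c;
  next a i := A i *m a + b i;
  proj _ := 1%:M;
  supp _ := [set: 'I_d]%SET
|}.

Lemma initial_piece (a : state initial) i x : adm a i ->
  (forall c, act a i c -> ev (cf c) x < 0) ->
  exists2 e0 : R, 0 < e0 & forall e, 0 < e -> e <= e0 -> piece i (a + e *: x).
Proof.
move=> ai ax; have [c ci|e0 e0_gt0 e0P] := small_perturbation
    (P := fun c => own c = i) (a := fun c => ev (cf c) a - bf c)
    (b := fun c => ev (cf c) x).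
  have := ai c ci; rewrite le_eqVlt subr_lt0 => /orP[/eqP ac|]; last by left.
  by right; split; [rewrite ac subrr|exact: ax].
exists e0 => // e e_gt0 ee0 c ci; have := e0P e e_gt0 ee0 c ci.
by rewrite evD evZ addrAC subr_lt0.
Qed.

(** Turns a tangent direction into actual points with the given itinerary, so that bounds along
    orbits apply to realized words. *)
Lemma initial_itinerary (a : state initial) w x : realizes cf A a w x ->
  exists2 e0 : R, 0 < e0 &
    forall e, 0 < e -> e <= e0 -> itinerary w (a + e *: x).
Proof.
elim: w a x => [|i w IHw] a x /=; first by exists 1.
case=> ai ax /IHw[e1 e1_gt0 e1P]; have [e2 e2_gt0 e2P] := initial_piece ai ax.
exists (Num.min e1 e2) => [|e e_gt0]; first by rewrite lt_min e1_gt0.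
rewrite le_min => /andP[ee1 ee2]; split; first exact: e2P.
by rewrite mulmxDr -scalemxAr addrAC; exact: e1P.
Qed.

Lemma initial_coherent (kappa : nat -> R) :
  (forall w x, itinerary w x -> forall y z : V,
    `|prodA A w *m y| * `|z| <= kappa (size w) * (`|y| * `|prodA A w *m z|)) ->
  coherent cf A initial d 1 kappa.
Proof.
move=> cond; split=> /=.
- move=> a i j x ai aj ix jx.
  have [e1 e1_gt0 e1P] := initial_piece ai ix.
  have [e2 e2_gt0 e2P] := initial_piece aj jx.
  apply: (@piece_disj _ _ (a + Num.min e1 e2 *: x)).
    by apply: e1P; rewrite ?lt_min ?e1_gt0// ge_min lexx.
  by apply: e2P; rewrite ?lt_min ?e1_gt0// ge_min lexx orbT.
- by move=> a i c x _; rewrite mul1mx => ->; rewrite /ev mulmx0 mxE.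
- move=> _ i x; rewrite !mul1mx; split=> [|->]; last by rewrite mulmx0.
  by move=> Ax; rewrite -(mulKmx (Aunit i) x) Ax mulmx0.
- by move=> _ x; rewrite !mul1mx.
- by move=> _ x j; rewrite inE.
- by move=> _; rewrite cardsT card_ord.
- by move=> _ x; rewrite mul1mx mul1r.
- move=> a w x /initial_itinerary[e0 e0_gt0 /(_ e0 e0_gt0 (lexx _))].
  exact: cond.
Qed.

(** The first hypothesis places [a] in every closed half-space containing [W], a form preserved by
    affine images and hence by the induction. A constraint that is an equality at [a] and strict at
    [x] is negative on [x - a]. *)
Lemma itinerary_realizes (W : set V) (a : V) w x :
  (forall (r : 'rV[R]_d) t, (forall y, W y -> ev r y <= t) -> ev r a <= t) ->
  (forall y, W y -> itinerary w y) -> itinerary w x ->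
  realizes cf A (a : state initial) w (x - a).
Proof.
elim: w W a x => [//|i w IHw] W a x hull Wi /= [ix wx]; split.
- by move=> c ci; apply: hull => y /Wi[/(_ c ci)/ltW].
- by move=> c [ci ac]; rewrite evB ac subr_lt0; exact: ix.
rewrite mulmxBr.
have -> : A i *m x - A i *m a = (A i *m x + b i) - (A i *m a + b i).
  by rewrite opprD addrACA subrr addr0.
apply: (IHw [set A i *m y + b i | y in W]) => //; last by move=> _ [y /Wi[_ ?] <-].
move=> r t Wt; rewrite evD -ev_mul -lerBrDr; apply: hull => y Wy.
by rewrite lerBrDr ev_mul -evD; apply: Wt; exists y.
Qed.

Lemma closure_halfspace (W : set V) a (r : 'rV[R]_d) t : closure W a ->
  (forall y, W y -> ev r y <= t) -> ev r a <= t.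
Proof.
move=> Wa Wt; have clH : closed ((ev r : V -> R) @^-1` [set s | s <= t]).
  apply: preimage_closed (@closed_le _ _) => x _.
  have -> : ev r = fun x : V => \sum_l r 0 l * x l 0.
    by apply/funext => y; rewrite /ev mxE.
  exact: (@lincomb_continuous R d 1 d (r 0) id (fun=> 0) x).
by move/closure_subset : Wt => /(_ a Wa); rewrite -(closure_id _).1.
Qed.

Lemma itinerary_growth (K lam : R) : 1 <= K -> 0 <= lam ->
  (forall w x, itinerary w x -> forall y z : V,
    `|prodA A w *m y| * `|z| <=
    K * expR ((size w)%:R * lam) * (`|y| * `|prodA A w *m z|)) ->
  forall eta, 0 < eta -> exists2 c : R, 1 <= c & forall (a : V) n,
    card_le (fun w => [/\ size w = n, itinerary w !=set0 &
      closure [set x | itinerary w x] a])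
    (c * expR (n%:R * ('C(d, 2)%:R * lam + eta))).
Proof.
move=> K1 lam0 cond eta eta0.
have coh := @initial_coherent (fun n => K * expR (n%:R * lam)) cond.
have [c c1 cP] := growth_bound Aunit K1 lam0 coh ltr01 eta0.
exists c => // a n; apply: (card_le_inj (g := id) (cP a n)); last by [].
move=> w [wn [x wx] wa]; split=> //; exists (x - a).
apply: itinerary_realizes wx; last by move=> y; exact.
by move=> r t; exact: closure_halfspace.
Qed.

End InitialSystem.

(** * Coding the continuity partition by words *)

Section Coding.
Context {R : realType} {d : nat}.
Local Notation V := 'cV[R]_d.
Variables (X : set V) (ZZ : set (set V)) (f : V -> V).
Hypotheses (hf : paff X ZZ f) (hnd : paff_nondegenerate ZZ f).

Lemma paff_data : exists (I C : finType) (own : C -> I) (cf : C -> 'rV[R]_d)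
    (bf : C -> R) (A : I -> 'M[R]_d) (b : I -> V),
  [/\ forall i j x, piece own cf bf i x -> piece own cf bf j x -> i = j,
      forall i, A i \in unitmx,
      forall i x, piece own cf bf i x ->
        f x = A i *m x + b i /\ dmap ZZ f x = A i,
      forall i, ZZ (piece own cf bf i) &
      forall Z, ZZ Z -> Z !=set0 -> exists i, Z = piece own cf bf i].
Proof.
(* Empty pieces are dropped, so that every letter has an invertible linear part. *)
pose ZZ0 : set (set V) := ZZ `&` [set Z | Z !=set0].
have ZZ0fin : finite_set ZZ0 := finite_setIl _ (paff_finite hf).
pose I : finType := fset_set ZZ0.
have IP (i : I) : ZZ0 (val i).
  by have := valP i; rewrite in_fset_set// inE.
have /choice[P PP] (i : I) : exists P : {m : nat & ('M[R]_(m, d) * 'cV[R]_m)%type},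
    val i = [set x | forall k, ((tagged P).1 *m x) k 0 < (tagged P).2 k 0].
  have [[m [B [b ->]]] _] := paff_polytope hf (IP i).1.
  by exists (existT _ m (B, b)).
pose A (i : I) := linear_part f (val i).
have /choice[b bP] (i : I) :
    exists b : V, forall x, val i x -> f x = A i *m x + b.
  by have /getPex := paff_affine hf (IP i).1.
pose C : finType := {i : I & 'I_(tag (P i))}.
pose own (c : C) := tag c.
pose cf (c : C) := row (tagged c) (tagged (P (tag c))).1.
pose bf (c : C) := (tagged (P (tag c))).2 (tagged c) 0.
have evE (c : C) x : ev (cf c) x =
    ((tagged (P (tag c))).1 *m x) (tagged c) 0.
  by rewrite /ev /cf -row_mul mxE.
have pieceE i : piece own cf bf i = val i.
  rewrite PP; apply/seteqP; split=> x /= ix.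
    by move=> k; have := ix (Tagged (fun i => 'I_(tag (P i))) k) erefl; rewrite evE.
  by move=> c ci; rewrite evE; subst i; exact: ix.
have disj (Z Z' : set V) x : ZZ Z -> ZZ Z' -> Z x -> Z' x -> Z = Z'.
  by move=> hZ hZ' Zx Z'x; apply: (paff_disjoint hf) => //; exists x.
exists I, C, own, cf, bf, A, b; split.
- move=> i j x; rewrite !pieceE => ix jx; apply: val_inj.
  exact: disj (IP i).1 (IP j).1 ix jx.
- by move=> i; apply: hnd; [exact: (IP i).1|exact: (IP i).2].
- move=> i x; rewrite pieceE => ix; split; first exact: bP.
  rewrite /dmap /A; congr linear_part.
  have [ZZg gx] : [set Z | ZZ Z /\ Z x] (get [set Z | ZZ Z /\ Z x]).
    by apply: getPex; exists (val i); split; [exact: (IP i).1|].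
  exact: disj ZZg (IP i).1 gx ix.
- by move=> i; rewrite pieceE; exact: (IP i).1.
- move=> Z hZ Z0; have ZI : Z \in fset_set ZZ0 by rewrite in_fset_set// inE.
  by exists [` ZI]%fset; rewrite pieceE.
Qed.

Lemma dmap_iterS n x :
  dmap_iter ZZ f n.+1 x = dmap_iter ZZ f n (f x) *m dmap ZZ f x.
Proof.
elim: n => [|n IHn]; first by rewrite /= mulmx1 mul1mx.
by rewrite -[LHS]/(dmap ZZ f (iter n.+1 f x) *m dmap_iter ZZ f n.+1 x) IHn
  iterSr mulmxA.
Qed.

Context {I C : finType}.
Variables (own : C -> I) (cf : C -> 'rV[R]_d) (bf : C -> R).
Variables (A : I -> 'M[R]_d) (b : I -> V).
Local Notation piece := (piece own cf bf).
Local Notation itinerary := (itinerary own cf bf A b).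
Hypothesis fE : forall i x, piece i x ->
  f x = A i *m x + b i /\ dmap ZZ f x = A i.
Hypothesis piece_in : forall i, ZZ (piece i).
Hypothesis piece_onto : forall Z, ZZ Z -> Z !=set0 -> exists i, Z = piece i.

Lemma itineraryP w x : itinerary w x ->
  prodA A w = dmap_iter ZZ f (size w) x /\
  forall k, (k < size w)%N -> paff_domain ZZ (iter k f x).
Proof.
elim: w x => [//|i w IHw] x [ix wx].
have [fx dx] := fE ix; rewrite -fx in wx; have [pw wdom] := IHw _ wx.
rewrite [size _]/= dmap_iterS -pw dx; split=> // -[_|k kw].
  by exists (piece i).
by rewrite iterSr; exact: wdom.
Qed.

Lemma itinerary_domain w x : (0 < size w)%N -> itinerary w x ->
  iter_domain X ZZ f (size w) x.
Proof.
move=> w0 /itineraryP[_ wx]; split=> //.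
exact: (paff_sub hf) (wx 0%N w0).
Qed.

Lemma coding n (Zs : nat -> set V) :
  (forall k, (k < n)%N -> ZZ (Zs k) /\ Zs k !=set0) ->
  exists2 w, size w = n & forall x, itinerary w x <->
    forall k, (k < n)%N -> Zs k (iter k f x).
Proof.
elim: n Zs => [|n IHn] Zs hZs; first by exists [::].
have [|w wn wP] := IHn (Zs \o succn); first by move=> k kn; exact: hZs.
have [hZ Z0] := hZs 0%N isT; have [i iE] := piece_onto hZ Z0.
exists (i :: w) => [|x]; first by rewrite /= wn.
split=> [[ix]|hx].
  rewrite -(fE ix).1 => /wP wx [_|k kn]; first by rewrite iE.
  by rewrite iterSr; exact: wx.
have ix : piece i x by rewrite -iE; exact: hx 0%N isT.
by split=> //; rewrite -(fE ix).1; apply/wP => k kn; rewrite -iterSr; exact: hx.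
Qed.

Lemma domain_itinerary n x : iter_domain X ZZ f n x ->
  exists2 w, size w = n & itinerary w x.
Proof.
move=> [_ xdom]; have /choice[Zs ZsP] k : exists Z, (k < n)%N ->
    ZZ Z /\ Z (iter k f x).
  have [kn|] := ltnP k n; last by exists set0.
  by have [Z hZ Zx] := xdom _ kn; exists Z.
have [k /ZsP[hZ Zx]|w wn wP] := @coding n Zs.
  by split=> //; exists (iter k f x).
by exists w => //; apply/wP => k /ZsP[].
Qed.

(** A cell is recovered from its word as the set of points with that itinerary, so choosing words is
    injective on cells. *)
Lemma multiplicity_le n c :
  (forall a, card_le (fun w => [/\ size w = n, itinerary w !=set0 &
      closure [set x | itinerary w x] a]) c) ->
  (multiplicity X (cont_partition ZZ f n) <= c%:E)%E.
Proof.
move=> hc; apply: ge_ereal_sup => _ [a _ <-]; rewrite lee_fin /multiplicity_at.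
set S := [set Z | _]; suff Sc : card_le S c.
  apply: Sc; first exact: fset_uniq.
  (* On an infinite set [fset_set] is empty by default, so membership already implies finiteness. *)
  move=> Z; rewrite /S /fset_set; case: pselect => [Sfin|]; last by rewrite inE.
  case: cid => /= E SE ZE; have : [set` E] Z by exact: ZE.
  by rewrite -SE.
have /choice[word wordP] (W : set V) : exists w : seq I,
    cont_partition ZZ f n W -> size w = n /\ W = [set x | itinerary w x].
  have [|nW] := pselect (cont_partition ZZ f n W); last by exists [::].
  case=> -[x Wx] [Zs [hZs WE]].
  have [k kn|w wn wP] := @coding n Zs.
    split; first exact: hZs.
    by exists (iter k f x); move: Wx; rewrite WE; exact.
  by exists w => _; split=> //; rewrite WE; apply/seteqP; split=> y /= /wP.
apply: (card_le_inj (g := word) (hc a)) => [W [Wn Wa]|W W' [Wn _] [W'n _] ww'].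
  have [wn WE] := wordP _ Wn; split=> //; last by rewrite -WE.
  by have [[x]] := Wn; rewrite {1}WE => ix _; exists x.
by rewrite (wordP _ Wn).2 (wordP _ W'n).2 ww'.
Qed.

End Coding.

(** * The Euclidean operator norm and condition numbers *)

Section OperatorNorm.
Context {R : realType} {d : nat}.
Local Notation V := 'cV[R]_d.
Implicit Types (x y z : V) (A : 'M[R]_d).

Lemma enorm_ge0 x : 0 <= enorm x.
Proof. exact: sqrtr_ge0. Qed.

Lemma norm_le_enorm x : `|x| <= enorm x.
Proof.
apply: norm_le_coord => [|i]; first exact: enorm_ge0.
rewrite -sqrtr_sqr ler_wsqrtr// (bigD1 i)//= lerDl.
by apply: sumr_ge0 => j _; rewrite sqr_ge0.
Qed.

Lemma enorm_le_norm x : enorm x <= d%:R * `|x|.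
Proof.
have dx : 0 <= d%:R * `|x| by rewrite mulr_ge0.
rewrite -[leRHS]ger0_norm// -sqrtr_sqr ler_wsqrtr//.
apply: (@le_trans _ _ (\sum_(i < d) `|x| ^+ 2)).
  apply: ler_sum => i _; rewrite -[leLHS]real_normK ?num_real//.
  by rewrite lerXn2r ?nnegrE// coord_le_norm.
rewrite sumr_const card_ord exprMn -[leLHS]mulr_natl ler_wpM2r ?sqr_ge0//.
by rewrite -natrX ler_nat; case: d => // k; rewrite leq_pmulr.
Qed.

Lemma enormZ t x : enorm (t *: x) = `|t| * enorm x.
Proof.
rewrite /enorm -sqrtr_sqr -sqrtrM ?sqr_ge0// mulr_sumr; congr Num.sqrt.
by apply: eq_bigr => i _; rewrite mxE exprMn.
Qed.

Lemma enorm0 : enorm (0 : V) = 0.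
Proof. by rewrite -(scale0r (0 : V)) enormZ normr0 mul0r. Qed.

Lemma enorm_eq0 x : enorm x = 0 -> x = 0.
Proof.
by move=> x0; apply/eqP; rewrite -normr_le0 -x0 norm_le_enorm.
Qed.

Lemma opnorm_has_sup A :
  has_sup [set enorm (A *m x) | x in [set x | enorm x <= 1]].
Proof.
split; first by exists (enorm (A *m 0)); exists 0; rewrite //= enorm0.
have [B B0 BP] := mulmx_norm_le A; exists (d%:R * B) => _ [x /= x1 <-].
apply: le_trans (enorm_le_norm _) _; rewrite ler_wpM2l//.
apply: le_trans (BP x) _; rewrite -[leRHS]mulr1 ler_wpM2l//.
exact: le_trans (norm_le_enorm x) x1.
Qed.

Lemma opnorm_ge0 A : 0 <= opnorm A.
Proof.
rewrite -enorm0; apply: ub_le_sup; first exact: (opnorm_has_sup A).2.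
by exists 0; rewrite /= ?mulmx0 ?enorm0.
Qed.

Lemma enorm_mul_le A x : enorm (A *m x) <= opnorm A * enorm x.
Proof.
have [/eqP/enorm_eq0->|x0] := boolP (enorm x == 0).
  by rewrite mulmx0 enorm0 mulr0.
have xgt0 : 0 < enorm x by rewrite lt_neqAle eq_sym x0 enorm_ge0.
rewrite -ler_pdivrMr// mulrC -[(enorm x)^-1]gtr0_norm ?invr_gt0// -enormZ scalemxAr.
apply: ub_le_sup; first exact: (opnorm_has_sup A).2.
by exists ((enorm x)^-1 *: x) => //=; rewrite enormZ gtr0_norm ?invr_gt0// mulVf.
Qed.

Lemma opnorm_le A B : 0 <= B -> (forall x, `|A *m x| <= B * `|x|) ->
  opnorm A <= d%:R * B.
Proof.
move=> B0 BP; apply: ge_sup; first exact: (opnorm_has_sup A).1.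
move=> _ [x /= x1 <-]; apply: le_trans (enorm_le_norm _) _.
rewrite ler_wpM2l//; apply: le_trans (BP x) _.
rewrite -[leRHS]mulr1 ler_wpM2l//; exact: le_trans (norm_le_enorm x) x1.
Qed.

Lemma norm_mul_opnorm A x : `|A *m x| <= d%:R * opnorm A * `|x|.
Proof.
apply: le_trans (norm_le_enorm _) _; apply: le_trans (enorm_mul_le _ _) _.
by rewrite mulrAC [leRHS]mulrC ler_wpM2l ?opnorm_ge0// enorm_le_norm.
Qed.

(** Passing between the sup and Euclidean norms costs a factor [d] for the matrix and another for
    its inverse. *)
Lemma condition_bound A y z : A \in unitmx -> `|A *m y| * `|z| <=
  d%:R ^+ 2 * (opnorm A * opnorm (invmx A)) * (`|y| * `|A *m z|).
Proof.
move=> Au; have z_le : `|z| <= d%:R * opnorm (invmx A) * `|A *m z|.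
  by rewrite -{1}(mulKmx Au z); exact: norm_mul_opnorm.
apply: le_trans (ler_pM _ _ (norm_mul_opnorm A y) z_le) _ => //.
by rewrite le_eqVlt; apply/orP; left; apply/eqP; ring.
Qed.

(** A nonzero vector is needed: in dimension 0 every [opnorm] is 0. *)
Lemma opnorm_mul_inv_ge1 A : (0 < d)%N -> A \in unitmx ->
  1 <= opnorm A * opnorm (invmx A).
Proof.
move=> d0 Au; pose x : V := const_mx 1.
have x0 : 0 < enorm x.
  rewrite lt_neqAle enorm_ge0 andbT eq_sym; apply/eqP => /enorm_eq0/matrixP.
  by move=> /(_ (Ordinal d0) 0); rewrite !mxE => /eqP; rewrite oner_eq0.
rewrite -(ler_pM2r x0) mul1r -mulrA -{1}(mulKVmx Au x).
apply: le_trans (enorm_mul_le _ _) _; rewrite ler_wpM2l ?opnorm_ge0//.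
exact: enorm_mul_le.
Qed.

End OperatorNorm.

(** * Exponential rates as extended-real upper limits *)

Section Limsup.
Context {R : realType}.
Local Open Scope ereal_scope.
Implicit Types (u : (\bar R)^nat) (l : \bar R).

Lemma limn_esup_le u l (N : nat) :
  (forall n, (N <= n)%N -> u n <= l) -> limn_esup u <= l.
Proof.
move=> h; apply: (@le_trans _ _ (ereal_sup [set u n | n in [set n | (N <= n)%N]])).
  by apply: ereal_inf_lbound; exists [set n | (N <= n)%N] => //; exists N.
by apply: ge_ereal_sup => _ [n /= /h un <-].
Qed.

Lemma limn_esup_ge u l (N : nat) :
  (forall n, (N <= n)%N -> l <= u n) -> l <= limn_esup u.
Proof.
move=> h; apply: le_ereal_inf_tmp => _ [A [M _ MA] <-].
apply: le_trans (h (maxn N M) (leq_maxl _ _)) _.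
by apply: ereal_sup_ubound; exists (maxn N M) => //; apply: MA; exact: leq_maxr.
Qed.

Lemma limn_esup_lt u l : limn_esup u < l ->
  exists N, forall n, (N <= n)%N -> u n <= l.
Proof.
move=> /ereal_inf_lt[_ [A [M _ MA] <-] ul]; exists M => n Mn.
by apply: le_trans (ltW ul); apply: ereal_sup_ubound; exists n => //; exact: MA.
Qed.

Lemma lne_le (x : \bar R) (t : R) : x <= (expR t)%:E -> lne x <= t%:E.
Proof.
case: x => [r||]//= rt; last by rewrite leNye.
case: ifPn => [_|]; first by rewrite leNye.
rewrite -ltNge => r0; rewrite lee_fin -ler_expR lnK ?posrE//.
Qed.

Lemma rate_le (n : nat) (r l : R) : (0 < n)%N ->
  ((n%:R)^-1)%:E * lne r%:E <= l%:E -> (r <= expR (n%:R * l))%R.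
Proof.
move=> n0 /=; case: ifPn => [r0 _|]; first exact: le_trans r0 (expR_ge0 _).
rewrite -ltNge => r0; rewrite -EFinM lee_fin mulrC ler_pdivrMr ?ltr0n// => h.
by rewrite -[r]lnK ?posrE// ler_expR mulrC.
Qed.

Lemma rate_ge (n : nat) (x : \bar R) (l : R) : (0 < n)%N ->
  x <= (expR (n%:R * l))%:E -> ((n%:R)^-1)%:E * lne x <= l%:E.
Proof.
move=> n0 /lne_le h; rewrite muleC lee_pdivrMr ?ltr0n// -EFinM.
by rewrite [(l * _)%R]mulrC.
Qed.

End Limsup.

(** The two-sided exponential bound on nonempty sets makes the upper limit a real number, around
    which an [eps] has meaning. *)
Lemma limn_esup_rate {R : realType} {V : Type} (U : nat -> set V)
    (v : nat -> V -> R) (T : R) :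
  (forall n, U n !=set0) ->
  (forall n x, (0 < n)%N -> U n x ->
    expR (n%:R * - T) <= v n x <= expR (n%:R * T)) ->
  exists l : R, limn_esup (fun n => ereal_sup
      [set ((n%:R^-1)%:E * lne (v n x)%:E)%E | x in U n]) = l%:E /\
    forall eps, 0 < eps -> exists N, forall n x, (N <= n)%N -> (0 < n)%N ->
      U n x -> v n x <= expR (n%:R * (l + eps)).
Proof.
move=> U0 vT; set u := fun n : nat => ereal_sup _.
have u_le : (limn_esup u <= T%:E)%E.
  apply: (@limn_esup_le _ _ _ 1) => n n0; apply: ge_ereal_sup => _ [x Ux <-].
  by apply: rate_ge => //; rewrite lee_fin; case/andP: (vT n x n0 Ux).
have u_ge : ((- T)%:E <= limn_esup u)%E.
  apply: (@limn_esup_ge _ _ _ 1) => n n0; have [x Ux] := U0 n.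
  apply: (@le_trans _ _ ((n%:R^-1)%:E * lne (v n x)%:E)%E); last first.
    by apply: ereal_sup_ubound; exists x.
  have /andP[v_ge _] := vT n x n0 Ux.
  have v0 : 0 < v n x := lt_le_trans (expR_gt0 _) v_ge.
  rewrite lne_EFin// -EFinM lee_fin mulrC ler_pdivlMr ?ltr0n// mulrC.
  by rewrite -ler_expR [leRHS]lnK.
have : limn_esup u \is a fin_num.
  rewrite fin_numElt (lt_le_trans (ltNyr _) u_ge)/=.
  exact: le_lt_trans u_le (ltry _).
move=> /fineK lE; exists (fine (limn_esup u)); split=> // eps eps0.
have [|N NP] := @limn_esup_lt _ u (fine (limn_esup u) + eps)%:E.
  by rewrite -{1}lE lte_fin ltrDl.
exists N => n x Nn n0 Ux; apply: rate_le => //.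
by apply: le_trans (NP n Nn); apply: ereal_sup_ubound; exists x.
Qed.

Lemma bin2_natr {R : realType} n :
  n%:R * (n%:R - 1) / 2 = ('C(n, 2))%:R :> R.
Proof.
elim: n => [|n IHn]; first by rewrite !mul0r.
by rewrite binS bin1 natrD -IHn -natr1; field.
Qed.

(** * From condition numbers to multiplicity entropy *)

Section Bound.
Context {R : realType} {d : nat} {I C : finType}.
Local Notation V := 'cV[R]_d.
Variables (X : set V) (ZZ : set (set V)) (f : V -> V).
Variables (own : C -> I) (cf : C -> 'rV[R]_d) (bf : C -> R).
Variables (A : I -> 'M[R]_d) (b : I -> V).
Local Notation piece := (piece own cf bf).
Local Notation itinerary := (itinerary own cf bf A b).
Hypothesis Xsub : paff_domain ZZ `<=` X.
Hypothesis piece_disj : forall i j x, piece i x -> piece j x -> i = j.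
Hypothesis Aunit : forall i, A i \in unitmx.
Hypothesis fE : forall i x, piece i x ->
  f x = A i *m x + b i /\ dmap ZZ f x = A i.
Hypothesis piece_onto : forall Z, ZZ Z -> Z !=set0 -> exists i, Z = piece i.

Lemma H_mult_le (K lam : R) : 1 <= K -> 0 <= lam ->
  (forall w x, itinerary w x -> forall y z : V,
    `|prodA A w *m y| * `|z| <=
    K * expR ((size w)%:R * lam) * (`|y| * `|prodA A w *m z|)) ->
  (H_mult X ZZ f <= ('C(d, 2)%:R * lam)%:E)%E.
Proof.
move=> K1 lam0 cond; apply/lee_addgt0Pr => e e0.
have e2 : 0 < e / 2 by rewrite divr_gt0.
have [c c1 cP] := itinerary_growth piece_disj Aunit K1 lam0 cond e2.
(* From this rank on the constant [c] costs at most [e / 2]; the other half of [e] is the loss in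
   the growth rate. *)
apply: (@limn_esup_le _ _ _ (Num.trunc (ln c / (e / 2))).+1) => n nN.
have n0 : (0 < n)%N := leq_ltn_trans (leq0n _) nN.
rewrite -EFinD; apply: rate_ge => //.
have mult_le := multiplicity_le X fE piece_onto (cP^~ n).
apply: le_trans mult_le _.
rewrite lee_fin -[c]lnK ?posrE ?(lt_le_trans ltr01)// -expRD ler_expR.
have : ln c <= n%:R * (e / 2).
  rewrite -ler_pdivrMr//; apply: le_trans (ltW (truncnS_gt _)) _.
  by rewrite ler_nat.
lra.
Qed.

(** Points of a cell are defined for all its steps, so no cells remain beyond [n0]. The multiplicity
    is then at most 0, with logarithm [-oo]. *)
Lemma H_mult_empty n0 : iter_domain X ZZ f n0 = set0 ->
  H_mult X ZZ f = -oo%E.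
Proof.
move=> Un0; apply/eqP; rewrite -leeNy_eq.
apply: (@limn_esup_le _ _ _ n0.+1) => n nn0.
have n_gt0 : (0 < n)%N := leq_ltn_trans (leq0n _) nn0.
have part0 : cont_partition ZZ f n = set0.
  rewrite -subset0 => W [[x Wx] [Zs [hZs WE]]].
  have dom k : (k < n)%N -> paff_domain ZZ (iter k f x).
    by move=> kn; exists (Zs k); [exact: hZs|move: Wx; rewrite WE; exact].
  have : iter_domain X ZZ f n0 x.
    split; first exact: Xsub (dom 0%N n_gt0).
    by move=> k kn0; apply: dom; exact: ltn_trans kn0 nn0.
  by rewrite Un0.
rewrite le0_lneNy ?gt0_muleNy ?lte_fin ?invr_gt0 ?ltr0n//.
apply: ge_ereal_sup => _ [a _ <-]; rewrite lee_fin /multiplicity_at.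
have -> : [set Z | cont_partition ZZ f n Z /\ closure Z a] = set0.
  by rewrite part0 -subset0 => Z [].
by rewrite fset_set0.
Qed.

(** A crude bound that serves to make the rates finite and to treat short words. *)
Lemma prodA_bound : exists2 B : R, 1 <= B & forall w (y : V),
  `|prodA A w *m y| <= B ^+ size w * `|y| /\
  `|y| <= B ^+ size w * `|prodA A w *m y|.
Proof.
have /choice[B1 B1P] i : exists B : R, 0 <= B /\
    forall x : V, `|A i *m x| <= B * `|x|.
  by have [B] := mulmx_norm_le (A i); exists B.
have /choice[B2 B2P] i : exists B : R, 0 <= B /\
    forall x : V, `|invmx (A i) *m x| <= B * `|x|.
  by have [B] := mulmx_norm_le (invmx (A i)); exists B.
pose B := 1 + \sum_i (B1 i + B2 i).
have B1B i : B1 i <= B /\ B2 i <= B.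
  have [p1 _] := B1P i; have [p2 _] := B2P i.
  have S0 : 0 <= \sum_(j | j != i) (B1 j + B2 j).
    apply: sumr_ge0 => j _; have [q1 _] := B1P j; have [q2 _] := B2P j.
    exact: addr_ge0.
  by rewrite /B (bigD1 i)//=; split; lra.
have B_ge1 : 1 <= B.
  rewrite lerDl; apply: sumr_ge0 => j _.
  by have [q1 _] := B1P j; have [q2 _] := B2P j; exact: addr_ge0.
have B0 : 0 <= B := le_trans ler01 B_ge1.
exists B => //; elim=> [|i w IHw] y; first by rewrite /= mul1mx expr0 mul1r.
have [IH1 IH2] := IHw (A i *m y); rewrite /= -mulmxA exprS.
have [Bi1 Bi2] := B1B i; split.
  apply: le_trans IH1 _; rewrite -mulrA mulrCA ler_wpM2l ?exprn_ge0//.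
  by apply: le_trans ((B1P i).2 y) _; rewrite ler_wpM2r.
rewrite -{1}(mulKmx (Aunit i) y); apply: le_trans ((B2P i).2 _) _.
by rewrite -mulrA; apply: ler_pM => //; exact: (B2P i).1.
Qed.

End Bound.

(** * Comparison of the expansion rates with the growth of condition numbers *)

Theorem corollary3 (R : realType) (d : nat) (X : set 'cV[R]_d)
    (ZZ : set (set 'cV[R]_d)) (f : 'cV[R]_d -> 'cV[R]_d)
    (hf : paff X ZZ f) (hnd : paff_nondegenerate ZZ f) :
  (H_mult X ZZ f <=
     ((d%:R * (d%:R - 1) / 2)%R)%:E * (lambda_max X ZZ f - lambda_min X ZZ f))%E.
Proof.
have [I [C [own [cf [bf [A [b [disj Aunit fE pin ponto]]]]]]]] :=
  paff_data hf hnd.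
have Xsub := paff_sub hf.
rewrite bin2_natr.
have [[n0 Un0]|Une] := pselect (exists n, iter_domain X ZZ f n = set0).
  by rewrite (H_mult_empty Xsub Un0) leNye.
have {}Une n : iter_domain X ZZ f n !=set0.
  by apply/set0P/eqP => Un; apply: Une; exists n.
have Hle := H_mult_le X disj Aunit fE ponto.
(* In dimension 0 the right side is 0 and all norms vanish, so the condition bound holds with
   [K = 1] and [lam = 0]. *)
have [d0|d_gt0] := posnP d.
  subst d; rewrite mul0e.
  have /= := Hle 1 0 (lexx _) (lexx _); rewrite mulr0; apply=> w x _ y z.
  have norm0 (v : 'cV[R]_0) : `|v| = 0 by rewrite (flatmx0 v) normr0.
  by rewrite !norm0 !mulr0.
have [B B1 BP] := prodA_bound Aunit.
have dB1 : 1 <= d%:R * B by rewrite mulr_ege1// ler1n.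
have dB0 : 0 < d%:R * B := lt_le_trans ltr01 dB1.
have B0 : 0 <= B := le_trans ler01 B1.
pose T := ln (d%:R * B).
have dBn n : (0 < n)%N -> d%:R * B ^+ n <= expR (n%:R * T).
  move=> n0; rewrite expRM_natl lnK// exprMn ler_wpM2r ?exprn_ge0//.
  rewrite -natrX ler_nat; case: n n0 => // n _.
  by rewrite expnS leq_pmulr// expn_gt0 d_gt0.
pose alpha n x := opnorm (dmap_iter ZZ f n x).
pose beta n x := opnorm (invmx (dmap_iter ZZ f n x)).
have code n x : iter_domain X ZZ f n x -> exists w, [/\ size w = n,
    prodA A w = dmap_iter ZZ f n x & prodA A w \in unitmx].
  move=> /(domain_itinerary fE ponto)[w wn wx]; exists w; split=> //.
    by rewrite (itineraryP fE pin wx).1 wn.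
  exact: prodA_unit.
have ab1 n x : iter_domain X ZZ f n x -> 1 <= alpha n x * beta n x.
  move=> /code[w [_ wE wu]]; rewrite /alpha /beta -wE.
  exact: opnorm_mul_inv_ge1.
have a_le n x : (0 < n)%N -> iter_domain X ZZ f n x ->
    alpha n x <= expR (n%:R * T).
  move=> n0 /code[w [wn wE wu]]; apply: le_trans (dBn n n0).
  apply: opnorm_le => [|y]; first exact: exprn_ge0.
  by rewrite -wE -wn; exact: (BP w y).1.
have b_le n x : (0 < n)%N -> iter_domain X ZZ f n x ->
    beta n x <= expR (n%:R * T).
  move=> n0 /code[w [wn wE wu]]; apply: le_trans (dBn n n0).
  apply: opnorm_le => [|y]; first exact: exprn_ge0.
  by rewrite -wE -wn; have := (BP w (invmx (prodA A w) *m y)).2; rewrite mulKVmx.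
(* Since [alpha * beta] is at least 1, an upper bound for one factor is a lower bound for the
   other. *)
have recip (p q t : R) : 0 <= p -> 1 <= p * q -> q <= expR t -> expR (- t) <= p.
  move=> p0 pq qt; rewrite expRN -[leLHS]mul1r ler_pdivrMr ?expR_gt0//.
  by apply: le_trans pq _; exact: ler_wpM2l.
have [|n x n0 Ux|l1 [l1E l1P]] := @limn_esup_rate _ _ (iter_domain X ZZ f) alpha T.
- exact: Une.
- rewrite a_le// mulrN andbT; apply: recip (opnorm_ge0 _) (ab1 _ _ Ux) _.
  exact: b_le.
have [|n x n0 Ux|l2 [l2E l2P]] := @limn_esup_rate _ _ (iter_domain X ZZ f) beta T.
- exact: Une.
- rewrite b_le// mulrN andbT; apply: recip (opnorm_ge0 _) _ (a_le _ _ n0 Ux).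
  by rewrite mulrC; exact: ab1.
(* [lambda_min] is [- l2], so the difference of the rates is [l1 + l2], which bounds the growth rate
   of condition numbers. *)
rewrite /lambda_max l1E /lambda_min l2E oppeK -EFinD -EFinM.
have lam_ge0 eps : 0 < eps -> 0 <= (l1 + eps) + (l2 + eps).
  move=> eps0; have [N1 N1P] := l1P _ eps0; have [N2 N2P] := l2P _ eps0.
  pose n := (maxn N1 N2).+1; have [x Ux] := Une n.
  have := N1P n x (leqW (leq_maxl _ _)) isT Ux.
  have := N2P n x (leqW (leq_maxr _ _)) isT Ux.
  move=> bn an; have := le_trans (ab1 n x Ux)
    (ler_pM (opnorm_ge0 _) (opnorm_ge0 _) an bn).
  by rewrite -expRD -mulrDr -[X in X <= _ -> _]expR0 ler_expR pmulr_rge0 ?ltr0n.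
apply/lee_addgt0Pr => e e0.
(* Raising both rates by [eps] costs [2 * 'C(d, 2)%:R * eps], at most [e]. The [+ 1] avoids a zero
   divisor when [d] is 1. *)
pose eps := e / (2 * ('C(d, 2)%:R + 1)).
have coef1 : 0 < 2 * ('C(d, 2)%:R + 1) :> R by rewrite mulr_gt0// ltr_wpDl.
have eps0 : 0 < eps by rewrite divr_gt0.
have [N1 N1P] := l1P _ eps0; have [N2 N2P] := l2P _ eps0.
pose N := (maxn N1 N2).+1.
pose lam := (l1 + eps) + (l2 + eps).
(* The first summand serves words of length at least [N], where the rates are effective; the second
   covers shorter words by the crude bound. *)
pose K := d%:R ^+ 2 + (B ^+ 2) ^+ N.
have d21 : 1 <= (d%:R : R) ^+ 2 by rewrite exprn_ege1// ler1n.
have BN1 : 1 <= (B ^+ 2) ^+ N by rewrite !exprn_ege1.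
have K1 : 1 <= K by rewrite /K; lra.
have lam0 : 0 <= lam := lam_ge0 _ eps0.
apply: le_trans (Hle K lam K1 lam0 _) _; last first.
  rewrite -EFinD lee_fin.
  have : 2 * 'C(d, 2)%:R * eps <= e.
    rewrite /eps mulrA ler_pdivrMr// mulrC ler_pM2l//; lra.
  by rewrite /lam; lra.
move=> w x wx y z; rewrite -mulrA.
have [wN|Nw] := ltnP (size w) N.
  have [wy _] := BP w y; have [_ wz] := BP w z.
  apply: le_trans (ler_pM _ _ wy wz) _ => //.
  rewrite mulrACA [leRHS]mulrA; apply: ler_wpM2r; first exact: mulr_ge0.
  rewrite -exprD addnn -mul2n exprM -[leLHS]mulr1; apply: ler_pM => //.
  - by rewrite exprn_ge0// exprn_ge0.
  - have : (B ^+ 2) ^+ size w <= (B ^+ 2) ^+ N.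
      by rewrite ler_weXn2l ?exprn_ege1// ltnW.
    by rewrite /K; lra.
  - by rewrite -expR0 ler_expR mulr_ge0.
have w0 : (0 < size w)%N := leq_ltn_trans (leq0n _) Nw.
have Ux := itinerary_domain hf fE pin w0 wx.
have [pE _] := itineraryP fE pin wx.
apply: le_trans (condition_bound y z (prodA_unit Aunit w)) _.
rewrite [leRHS]mulrA; apply: ler_wpM2r; first exact: mulr_ge0.
have N1w : (N1 <= size w)%N by rewrite (leq_trans _ (ltnW Nw))// leq_maxl.
have N2w : (N2 <= size w)%N by rewrite (leq_trans _ (ltnW Nw))// leq_maxr.
apply: ler_pM.
- exact: le_trans ler01 d21.
- by rewrite mulr_ge0 ?opnorm_ge0.
- by rewrite /K; lra.
rewrite /lam mulrDr expRD pE.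
by apply: ler_pM; rewrite ?opnorm_ge0//; [exact: N1P|exact: N2P].
Qed.
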